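(* Let $N\in\mathbb{N}$ with $N\geq2$, let $s\in(1,N)$, and let $m\in\mathbb{N}$ (so $m\geq1$) with $m\leq s$. There exists an Ahlfors $s$-regular curve $E\subset\mathbb{R}^N$ which is not contained in a $(m/s)$-Hölder image of $[0,1]^m$; that is, there is no map $f:[0,1]^m\to\mathbb{R}^N$ and finite constant $H$ with $|f(x)-f(y)|\leq H|x-y|^{m/s}$ for all $x,y\in[0,1]^m$ and $E\subset f([0,1]^m)$.
   Context: A curve is a continuous image of $[0,1]$. With $\mathcal{H}^s$ denoting $s$-dimensional Hausdorff measure and $B(x,r)$ the ball of center $x$ and radius $r$, a set $E\subset\mathbb{R}^N$ is Ahlfors $s$-regular if there exist $0<c\leq C<\infty$ such that $c\,r^s\leq\mathcal{H}^s(E\cap B(x,r))\leq C\,r^s$ for all $x\in E$ and $0<r\leq\operatorname{diam}E$. Curves here are nondegenerate (contain at least two points). *)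

(* Defs.v *)
From HB Require Import structures.
From mathcomp Require Import all_boot all_order all_algebra.
From mathcomp Require Import all_classical all_reals all_analysis.

Set Implicit Arguments.
Unset Strict Implicit.
Unset Printing Implicit Defensive.

Import Order.TTheory GRing.Theory Num.Theory.
Import numFieldNormedType.Exports.

Local Open Scope classical_set_scope.
Local Open Scope ring_scope.

(* R^n is 'rV[R]_n: its library topology is the usual (product) one, but the
   library norm `|x| is the sup norm, so all metric notions below are stated
   with the Euclidean norm. *)
Definition enorm (R : realType) (n : nat) (x : 'rV[R]_n) : R :=
  Num.sqrt (\sum_(i < n) x 0 i ^+ 2).

Definition eball (R : realType) (n : nat) (x : 'rV[R]_n) (r : R) :
    set 'rV[R]_n :=
  [set y | enorm (y - x) <= r].

(* The point 0 in the supremum only matters for the empty set. *)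
Definition ediam (R : realType) (n : nat) (A : set 'rV[R]_n) : \bar R :=
  ereal_sup (0%E |` [set d | exists x y,
    [/\ A x, A y & d = (enorm (x - y))%:E]]).

(* The two Hausdorff set functions below are meant for 0 < s: 0 `^ 0 = 1, so at
   s = 0 the empty sets of a cover would be counted. *)
Definition hausdorff_delta (R : realType) (n : nat) (s delta : R)
    (A : set 'rV[R]_n) : \bar R :=
  ereal_inf [set v | exists U : nat -> set 'rV[R]_n,
    [/\ A `<=` \bigcup_k U k,
        forall k, (ediam (U k) <= delta%:E)%E &
        v = (\sum_(0 <= k <oo) ediam (U k) `^ s)%E]].

Definition hausdorff_measure (R : realType) (n : nat) (s : R)
    (A : set 'rV[R]_n) : \bar R :=
  ereal_sup [set hausdorff_delta s delta A | delta in [set d : R | 0 < d]].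

Definition ahlfors_regular (R : realType) (n : nat) (s : R)
    (E : set 'rV[R]_n) : Prop :=
  exists c C : R, [/\ 0 < c, c <= C &
    forall (x : 'rV[R]_n) (r : R), E x -> 0 < r -> (r%:E <= ediam E)%E ->
      ((c * r `^ s)%:E <= hausdorff_measure s (E `&` eball x r))%E /\
      (hausdorff_measure s (E `&` eball x r) <= (C * r `^ s)%:E)%E].

Definition curve (R : realType) (n : nat) (E : set 'rV[R]_n) : Prop :=
  (exists g : R -> 'rV[R]_n,
     {within `[0, 1]%classic, continuous g} /\ g @` `[0, 1]%classic = E) /\
  (exists x y, [/\ E x, E y & x <> y]).

Definition unit_cube (R : realType) (m : nat) : set 'rV[R]_m :=
  [set x | forall i, 0 <= x 0 i <= 1].
Arguments unit_cube : clear implicits.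

Definition hoelder_on (R : realType) (m n : nat) (alpha : R)
    (A : set 'rV[R]_m) (f : 'rV[R]_m -> 'rV[R]_n) : Prop :=
  exists H : R, forall x y, A x -> A y ->
    enorm (f x - f y) <= H * enorm (x - y) `^ alpha.

(* Main.v *)
Require Import Defs.
From mathcomp Require Import all_boot all_order all_algebra zify ring lra.
From mathcomp Require Import all_classical all_reals all_analysis.
Import Order.TTheory GRing.Theory Num.Theory.
Import numFieldNormedType.Exports.

Set Implicit Arguments.
Unset Strict Implicit.
Unset Printing Implicit Defensive.

(** Two ideas are combined: a set that no (m/s)-Hoelder map of the m-cube can
    cover, and a tree of cubes that makes such a set an s-regular curve.

    The obstruction is a budget. If f is (m/s)-Hoelder with constant H, a ball
    of radius rho in the unit m-cube has volume about rho^m and its image has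
    diameter at most H rho^(m/s); hence f spends a volume of at least a constant
    times r^s near each value, within distance r of it. Let E contain thin
    vertical columns of width r, separated from one another by horizontal moats
    of width comparable to r, and look at a segment of height kr of a column.
    A ball of the m-cube whose image has diameter about kr and meets the middle
    of the segment is connected. Either its image stays along the segment,
    which costs a volume (kr)^s although the segment carries only the share
    k r^s of the s-dimensional mass of E; or its image enters the moat and f
    spends a volume r^s inside the moat ([box_or_moat]). As s > 1, once k is
    large the first case can occur for at most half of the segments, because
    the total volume is 1. So the moats of width r absorb a fraction of the
    volume that is bounded below, uniformly in r. Columns over J stages of a
    Cantor set have disjoint moats at J scales, and for J large the volume is
    exhausted ([limit_not_hoelder]). Volumes in the m-cube are measured by
    counting the points of a fine lattice.

    The curve E is the limit of a tree of b-adic cubes. Every cube of level n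
    has exactly b c_n children, where the c_n are chosen so that the number of
    cubes of level n stays within a factor 2 of b^(ns). This count alone makes
    E Ahlfors s-regular, wherever the children are placed
    ([ladder_ahlfors]): the upper bound comes from covers by cubes, the lower
    one from the mass distribution principle. The placement of the children is
    therefore free to serve the other two purposes. A cube of net type has
    children that contain all its corners and form a chain of touching cubes. A
    cube of column type has as children full vertical columns over a set of
    cells that avoids the sides of the cube, which creates the moats. At sparse
    levels, the milestones, every cube is of net type, and exactly one of
    its children starts a bundle of columns that lasts until the next
    milestone. The bundles thus have a share of the mass that is bounded below,
    and as the distance between milestones grows they show columns at
    arbitrarily many consecutive scales.

    Below a cube of a milestone, the cubes of the next milestone form a chain of
    touching cubes, since each column can be followed down to the net cube on
    which it stands ([below_linked]). So a walk through all cubes of one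
    milestone, with successive cubes touching, refines to such a walk for the
    next one ([nested_walks]), and the walks converge to a continuous
    surjection from the unit interval to E ([limit_curve]). *)

(** * Digit patterns *)

(** The base is [e.+1], so that digits are ordinals; the ambient dimension is
    [d.+2], and coordinate [ord0] is the vertical one. *)
Definition digits (d e : nat) := {ffun 'I_d.+2 -> 'I_e.+1}.

Definition set_height d e (a : digits d e) (y : 'I_e.+1) : digits d e :=
  [ffun i => if i == ord0 then y else a i].

Definition shrink d e (k : nat) (a : digits d e) : digits d e :=
  [ffun i => if i == ord0 then a i else inord (a i - k)].

Definition flat d e (a : digits d e) := [forall i, (i != ord0) ==> (a i == ord0)].

(** The parent map of a tree rooted at 0 whose edges join touching cells: first
    diagonally to the vertical axis, then down the axis. Connectivity of a set of
    digits becomes the closure property of being stable under this map. *)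
Definition retract d e (a : digits d e) : digits d e :=
  if flat a then set_height a (inord (a ord0).-1) else shrink 1 a.

(** Sits just above a corner. Since a horizontal coordinate has the top value, it is
    not a value of [retract], so that it can be removed from a stable set. *)
Definition ladder_digit d e : digits d e :=
  [ffun i => if i == ord0 then inord 1 else ord_max].

Definition corner d e (a : digits d e) := [forall i, (a i == ord0) || (a i == ord_max)].

(** [K] is the set of children of a cell of net type and [L] that of a cell of
    column type. They have the same cardinality because only the number of children
    may enter the mass of a cell. [column_inner] creates the moats around columns,
    and [connected_top] lets a column stand on a net cell. *)
Record pattern_pair (d e c : nat) (K L : {set digits d e}) : Prop := PatternPair {
  card_connected : #|K| = (e.+1 * c)%N;
  card_column_slice : forall y, #|[set a in L | a ord0 == y]| = c;
  column_inner : forall a i, a \in L -> i != ord0 -> (0 < a i < e)%N;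
  column_vertical : forall a y, a \in L -> set_height a y \in L;
  connected_top : forall a, a \in L -> set_height a ord_max \in K;
  connected_corner : forall a, corner a -> a \in K;
  connected_retract : forall a, a \in K -> a != ladder_digit d e ->
    retract a \in K;
  connected_ladder : ladder_digit d e \in K }.

Lemma val_inord_le e (y : 'I_e.+1) k : k <= y -> nat_of_ord (inord k : 'I_e.+1) = k.
Proof. by move=> ky; rewrite inordK // ltnS (leq_trans ky) // -ltnS ltn_ord. Qed.

(** Adding a missing element of least rank preserves stability under [f], as its image
    has smaller rank and so is already present. *)
Lemma closed_set_of_card (T : finType) (U S : {set T}) (rk : T -> nat)
    (f : T -> T) (z : T) (p : nat) :
  S \subset U -> (forall a, a \in S -> a != z -> f a \in S) ->
  (forall a, a \in U -> a != z -> (f a \in U) && (rk (f a) < rk a)) ->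
  #|S| <= p <= #|U| ->
  exists S' : {set T}, [/\ S \subset S', S' \subset U,
    (forall a, a \in S' -> a != z -> f a \in S') & #|S'| = p].
Proof.
move=> SU clS clU /andP[Sp pU].
have [k pk] : exists k, p = #|S| + k by exists (p - #|S|); rewrite subnKC.
elim: k S SU clS Sp pk => [|k IH] S SU clS Sp pk.
  by exists S; split=> //; rewrite pk addn0.
have ltSU : #|S| < #|U| by rewrite (leq_trans _ pU) // pk addnS ltnS leq_addr.
have /set0Pn[a0 a0in] : U :\: S != finset.set0.
  apply: contraTneq ltSU => US0; rewrite -leqNgt subset_leq_card //.
  by rewrite -finset.setD_eq0 US0.
have [a ain amin] := @arg_minnP _ a0 [in U :\: S] rk a0in.
move: ain; rewrite /= inE => /andP[aS aU].
have [||||S' [SS' S'U clS' cS']] := IH (a |: S).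
- by rewrite finset.subUset finset.sub1set aU.
- move=> x; rewrite !inE => /orP[/eqP-> za|xS xz]; last by rewrite clS ?orbT.
  have /andP[faU rkfa] := clU a aU za.
  case faS: (f a \in S); first by rewrite orbT.
  have := amin (f a); rewrite /= inE faU faS => /(_ isT).
  by rewrite leqNgt rkfa.
- by rewrite cardsU1 aS pk addnS add1n ltnS leq_addr.
- by rewrite cardsU1 aS pk addnS add1n addSn.
exists S'; split=> //; apply: fintype.subset_trans SS'; exact: finset.subsetUr.
Qed.

Lemma card_columns d e c (K L : {set digits d e}) :
  pattern_pair c K L -> #|L| = (e.+1 * c)%N.
Proof.
move=> H; rewrite -sum1_card (partition_big (fun a : digits d e => a ord0) predT) //=.
rewrite -[e.+1 in RHS]card_ord -sum_nat_const; apply: eq_bigr => y _.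
by rewrite -(card_column_slice H y) -sum1dep_card.
Qed.

Section Retract.
Variables d e : nat.
Implicit Types a : digits d e.

Lemma retract_adj a i : (retract a i <= a i) && (a i <= (retract a i).+1).
Proof.
rewrite /retract /set_height /shrink; case: ifP => _; rewrite !ffunE; case: eqP => [->|] //.
- by rewrite (val_inord_le (leq_pred _)) // leq_pred leqSpred.
- by rewrite leqnn leqnSn.
- by rewrite leqnn leqnSn.
- by move=> _; rewrite (val_inord_le (leq_subr _ _)) // subn1 leq_pred leqSpred.
Qed.

Lemma retract_rank a : a != [ffun => ord0] ->
  \sum_i (retract a i : nat) < \sum_i (a i : nat).
Proof.
move=> anz; have le i : retract a i <= a i by have /andP[] := retract_adj a i.
suff [i lti] : exists i, retract a i < a i.
  by rewrite (bigD1 i) //= [ltnRHS](bigD1 i) //= -addSn leq_add // leq_sum.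
case: (boolP (flat a)) => fa; rewrite /retract ?fa ?(negbTE fa).
  exists ord0; rewrite !ffunE eqxx.
  have a0 : a ord0 != ord0.
    apply: contra anz => /eqP a0; apply/eqP/ffunP=> i; rewrite ffunE.
    case: (eqVneq i ord0) => [->//|i0].
    by have /forallP/(_ i) := fa; rewrite i0 => /eqP.
  have {}a0 : 0 < a ord0 by rewrite lt0n; apply: contra a0 => /eqP a0; apply/eqP/val_inj.
  by rewrite (val_inord_le (leq_pred _)) // ltn_predL.
move: fa; rewrite negb_forall => /existsP[i]; rewrite negb_imply => /andP[i0 ai].
have {}ai : 0 < a i by rewrite lt0n; apply: contra ai => /eqP a0; apply/eqP/val_inj.
by exists i; rewrite ffunE (negbTE i0) (val_inord_le (leq_subr _ _)) // subn1 ltn_predL.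
Qed.

End Retract.

Lemma val_shrink d e k (a : digits d e) i : i != ord0 -> shrink k a i = a i - k :> nat.
Proof.
by move=> i0; rewrite ffunE (negbTE i0) (val_inord_le (leq_subr _ _)).
Qed.

Lemma shrink_shrink d e j k (a : digits d e) : shrink j (shrink k a) = shrink (k + j) a.
Proof.
apply/ffunP=> i; case: (eqVneq i ord0) => [->|i0]; first by rewrite !ffunE.
by apply: val_inj; rewrite /= !val_shrink // subnDA.
Qed.

Lemma retract_neq_ladder d e (a : digits d e) : 0 < e -> retract a != ladder_digit d e.
Proof.
move=> e0; apply/eqP => /ffunP/(_ (lift ord0 ord0)); rewrite /retract.
have i0 : lift ord0 ord0 != ord0 :> 'I_d.+2 by [].
case: ifP => [/forallP/(_ (lift ord0 ord0))|_].
  by rewrite !ffunE /= => /eqP-> [] e00; rewrite -e00 in e0.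
move=> /(congr1 val); rewrite /= val_shrink // ffunE /= => E.
by move: (leq_ord (a (lift ord0 ord0))) E; case: (nat_of_ord _); lia.
Qed.

Lemma subset_of_card (T : finType) (A : {set T}) c :
  c <= #|A| -> exists2 B : {set T}, B \subset A & #|B| = c.
Proof.
move=> cA; exists [set x in take c (enum A)].
  by apply/fintype.subsetP=> x; rewrite inE => /mem_take; rewrite mem_enum.
rewrite cardsE; have /card_uniqP-> : uniq (take c (enum A)) by rewrite take_uniq ?enum_uniq.
by rewrite size_take -cardE; case: ltngtP cA.
Qed.

Lemma card_corners d e : #|[set a : digits d e | corner a]| <= 2 ^ d.+2.
Proof.
pose f (x : {ffun 'I_d.+2 -> bool}) : digits d e := [ffun i => if x i then ord_max else ord0].
apply: leq_trans (_ : #|f @: finset.setT| <= _); last first.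
  by rewrite (leq_trans (leq_imset_card _ _)) // cardsT card_ffun card_bool card_ord.
apply: subset_leq_card; apply/fintype.subsetP=> a; rewrite inE => /forallP ca.
apply/imsetP; exists [ffun i => a i == ord_max] => //.
apply/ffunP=> i; rewrite !ffunE; case: eqP => // ai.
by have := ca i => /orP[/eqP //|/eqP].
Qed.

Lemma card_top_columns d e h : h <= e ->
  #|[set a : digits d e | (a ord0 == ord_max) && [forall i, (i != ord0) ==> (0 < a i <= h)]]|
    = h ^ d.+1.
Proof.
move=> he.
pose R := [set (inord k.+1 : 'I_e.+1) | k : 'I_h].
have inR y : (y \in R) = (0 < y <= h).
  apply/imsetP/idP => [[k _ ->]|]; first by rewrite inordK ?ltn_ord // ltnS (leq_trans _ he).
  case: y => -[|y] lty /= yh; first by []. exists (Ordinal yh) => //.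
  by apply: val_inj; rewrite /= inordK.
have -> : #|[set a : digits d e |
    (a ord0 == ord_max) && [forall i, (i != ord0) ==> (0 < a i <= h)]]|
    = #|pffun_on (ord_max : 'I_e.+1) (predC1 (ord0 : 'I_d.+2)) [in R]|.
  apply: eq_card => a; rewrite inE; apply/andP/pffun_onP => [[/eqP a0 /forallP ah]|[a0 ah]].
    split; first by apply/finfun.supportP => i; rewrite inE negbK => /eqP->.
    by move=> y /fintype.imageP[i] i0 ->; rewrite inR; have := ah i; rewrite (i0 : i != ord0).
  split; first by apply/eqP; apply: (elimT finfun.supportP a0); rewrite inE negbK.
  apply/forallP=> i; apply/implyP=> i0; rewrite -inR; apply: ah; exact: fintype.image_f.
rewrite card_pffun_on cardC1 card_ord; congr (_ ^ _).
rewrite card_imset ?card_ord // => j k /(congr1 val).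
by rewrite /= !inordK ?ltnS ?(leq_trans _ he) // => -[] /val_inj.
Qed.

Lemma card_imset_ord (T U : finType) (A : {set T}) n (f : T -> 'I_n -> U) :
  #|[set f a k | a in A, k in 'I_n]| <= #|A| * n.
Proof.
apply: leq_trans (_ : #|(fun x : T * 'I_n => f x.1 x.2) @: finset.setX A finset.setT| <= _); last first.
  by rewrite (leq_trans (leq_imset_card _ _)) // cardsX cardsT card_ord.
apply: subset_leq_card; apply/fintype.subsetP=> y /imset2P[a k aA _ ->].
by apply/imsetP; exists (a, k); rewrite // !inE aA.
Qed.

(** The columns stand over [c] cells with horizontal coordinates in [1, h], and
    [h <= b / 2]: the path of [retract] from the top of a column to the axis then has
    at most [h.+1] cells. With the paths from the corners and the axis itself, this
    gives fewer than [b c] cells, and [closed_set_of_card] fills the net up to the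
    exact number. *)
Lemma pattern_pair_exists d e h c : 4 <= h -> h.*2 <= e.+1 -> 2 ^ (d + 5) <= c ->
  c <= h ^ d.+1 -> exists K L, @pattern_pair d e c K L.
Proof.
move=> h4 he cbig ch.
have hle : h <= e by lia.
have [C CU cardC] : exists2 C : {set digits d e}, C \subset [set a : digits d e |
    (a ord0 == ord_max) && [forall i, (i != ord0) ==> (0 < a i <= h)]] & #|C| = c.
  by apply: subset_of_card; rewrite card_top_columns.
pose L := [set a : digits d e | set_height a ord_max \in C].
pose ell := ladder_digit d e.
(* Descents of the tops, descents of the corners, and the vertical axis. *)
pose S1 := [set shrink (k : 'I_h.+1) a | a in C, k in 'I_h.+1].
pose S2 := [set shrink (k : 'I_e.+1) a | a in [set a : digits d e | corner a], k in 'I_e.+1].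
pose S3 := [set (set_height [ffun => ord0] y : digits d e) | y : 'I_e.+1].
pose S := S1 :|: S2 :|: S3.
have CP a : a \in C -> a ord0 = ord_max /\ forall i, i != ord0 -> 0 < a i <= h.
  move=> /(fintype.subsetP CU); rewrite inE => /andP[/eqP-> /forallP ah]; split=> // i i0.
  by have := ah i; rewrite (i0 : i != ord0).
have i1 : lift ord0 ord0 != ord0 :> 'I_d.+2 by [].
have ell1 : ell (lift ord0 ord0) = e :> nat by rewrite ffunE.
have ell0 : ell ord0 = 1 :> nat by rewrite ffunE eqxx inordK //; lia.
have sh_ell k a : shrink k a = ell -> a ord0 = 1 :> nat.
  by move=> E; rewrite -ell0 -E ffunE eqxx.
have SU : S \subset ~: [set ell].
  apply/fintype.subsetP=> a; rewrite !inE => /orP[/orP[]|].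
  - case/imset2P=> b k bC _ ->; apply/eqP => /sh_ell; have [-> _] := CP _ bC.
    by move=> /=; lia.
  - case/imset2P=> b k; rewrite inE => /forallP/(_ ord0) b0 _ ->; apply/eqP => /sh_ell.
    by case/orP: b0 => /eqP-> //=; lia.
  - case/imsetP=> y _ ->; apply/eqP => /(congr1 (fun a : digits d e => val (a (lift ord0 ord0)))).
    by rewrite /= ell1 !ffunE /=; lia.
have flatS a : a \in S -> flat a -> retract a \in S.
  move=> aS fa; rewrite !inE; apply/orP; right; apply/imsetP; exists (inord (a ord0).-1) => //.
  rewrite /retract fa; apply/ffunP=> i; rewrite !ffunE; case: ifP => // i0.
  by have /forallP/(_ i) := fa; rewrite i0 => /eqP.
have clS a : a \in S -> a != [ffun => ord0] -> retract a \in S.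
  move=> aS _; case fa: (flat a); first exact: flatS.
  rewrite /retract fa; move: aS; rewrite !inE => /orP[/orP[]|].
  - case/imset2P=> b k bC _ E; apply/orP; left; apply/orP; left.
    have kh : k < h.
      rewrite ltn_neqAle -ltnS ltn_ord andbT; apply/negP => /eqP kh.
      suff : flat a by rewrite fa.
      apply/forallP=> i; apply/implyP=> i0; apply/eqP/val_inj; rewrite /= E val_shrink //.
      by apply/eqP; rewrite subn_eq0 kh; have [_ /(_ i i0)/andP[]] := CP _ bC.
    apply/imset2P; exists b (Ordinal (kh : k.+1 < h.+1)) => //.
    by rewrite E shrink_shrink addn1.
  - case/imset2P=> b k bC _ E; apply/orP; left; apply/orP; right.
    have kh : k < e.
      rewrite ltn_neqAle -ltnS ltn_ord andbT; apply/negP => /eqP kh.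
      suff : flat a by rewrite fa.
      apply/forallP=> i; apply/implyP=> i0; apply/eqP/val_inj; rewrite /= E val_shrink //.
      by apply/eqP; rewrite subn_eq0 kh leq_ord.
    apply/imset2P; exists b (Ordinal (kh : k.+1 < e.+1)) => //.
    by rewrite E shrink_shrink addn1.
  - case/imsetP=> y _ E; suff : flat a by rewrite fa.
    by apply/forallP=> i; apply/implyP=> i0; rewrite E !ffunE (negbTE i0).
have cS : #|S| <= (e.+1 * c).-1.
  have c1 : #|S1| <= c * h.+1.
    by rewrite -cardC; apply: card_imset_ord.
  have c2 : #|S2| <= 2 ^ d.+2 * e.+1.
    apply: leq_trans (leq_mul (card_corners d e) (leqnn _)).
    exact: card_imset_ord.
  have c3 : #|S3| <= e.+1 by rewrite (leq_trans (leq_imset_card _ _)) // card_ord.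
  have : #|S| <= c * h.+1 + 2 ^ d.+2 * e.+1 + e.+1.
    rewrite (leq_trans (leq_card_setU _ _)) // leq_add //.
    by rewrite (leq_trans (leq_card_setU _ _)) // leq_add.
  have : 1 <= 2 ^ d.+2 by rewrite expn_gt0.
  by move: cbig; rewrite expnD !expnS expn0; nia.
have cU : #|~: [set ell]| = (e.+1 ^ d.+2).-1.
  by rewrite cardsC1 card_ffun !card_ord.
have [||K [SK KU clK cK]] := closed_set_of_card (rk := fun a : digits d e => \sum_i (a i : nat))
  (p := (e.+1 * c).-1) SU clS.
- move=> a _ anz; rewrite retract_rank // andbT inE inE retract_neq_ladder //; lia.
- rewrite cS cU -!subn1 leq_sub2r // expnS leq_mul2l (leq_trans ch) ?orbT //.
  by rewrite leq_exp2r //; lia.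
exists (ell |: K), L; split.
- have ellK : ell \notin K by apply/negP => /(fintype.subsetP KU); rewrite !inE eqxx.
  by rewrite cardsU1 ellK cK add1n prednK // muln_gt0 /=; have := expn_gt0 2 (d + 5); lia.
- move=> y; rewrite -cardC.
  rewrite -(@card_in_imset _ _ (fun a : digits d e => set_height a y) C).
    apply: eq_card => a; rewrite !inE; apply/andP/imsetP => [[aL /eqP ay]|[b bC ->]].
      exists (set_height a ord_max) => //; apply/ffunP=> i; rewrite !ffunE.
      by case: eqP => [->|].
    rewrite !ffunE eqxx; split=> //.
    suff -> : set_height (set_height b y) ord_max = b by [].
    by apply/ffunP=> i; rewrite !ffunE; case: eqP => [->|//]; have [->] := CP _ bC.
  move=> a b aC bC /ffunP E; apply/ffunP=> i.
  have := E i; rewrite !ffunE; case: eqP => [->|//].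
  by have [-> _] := CP _ aC; have [-> _] := CP _ bC.
- move=> a i; rewrite inE => /CP[_ aP] i0; have := aP i i0.
  rewrite ffunE (negbTE i0) => /andP[-> ah] /=; apply: leq_ltn_trans ah _; lia.
- move=> a y; rewrite !inE => aC.
  suff -> : set_height (set_height a y) ord_max = set_height a ord_max by [].
  by apply/ffunP=> i; rewrite !ffunE; case: eqP.
- move=> a; rewrite inE => aC; rewrite inE; apply/orP; right; apply: (fintype.subsetP SK).
  rewrite !inE; apply/orP; left; apply/orP; left; apply/imset2P.
  exists (set_height a ord_max) ord0 => //; apply/ffunP=> i; apply/val_inj.
  case: (eqVneq i ord0) => [->|i0] /=; first by rewrite !ffunE.
  by rewrite val_shrink // subn0.
- move=> a ca; rewrite inE; apply/orP; right; apply: (fintype.subsetP SK).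
  rewrite !inE; apply/orP; left; apply/orP; right; apply/imset2P.
  exists a ord0 => //; first by rewrite inE.
  apply/ffunP=> i; apply/val_inj.
  case: (eqVneq i ord0) => [->|i0] /=; first by rewrite !ffunE.
  by rewrite val_shrink // subn0.
- move=> a; rewrite !inE => /orP[-> //|aK] aell; apply/orP; right.
  case: (eqVneq a [ffun => ord0]) => [E|]; last exact: clK.
  suff -> : retract a = a by [].
  rewrite E /retract; case: ifP => [_|/negbT/negP[]].
    by apply/ffunP=> i; rewrite !ffunE; case: eqP => // _; apply: val_inj; rewrite /= inordK.
  by apply/forallP=> i; rewrite ffunE eqxx implybT.
- by rewrite setU11.
Qed.

(** * Trees of cells *)

(** The index [p] of level [n] stands for the cube of side [b ^ - n] with lower corner
    [p / b ^ n], where [b = e.+1]. *)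
Definition cell (d : nat) := {ffun 'I_d.+2 -> nat}.

Definition parent (e : nat) d (p : cell d) : cell d := [ffun i => p i %/ e.+1].

Definition ancestor (e k : nat) d (p : cell d) : cell d := [ffun i => p i %/ e.+1 ^ k].

Definition digit (e : nat) d (p : cell d) : digits d e := [ffun i => inord (p i %% e.+1)].

Definition child e d (p : cell d) (a : digits d e) : cell d :=
  [ffun i => p i * e.+1 + a i].

Record ladder (d e : nat) := Ladder {
  milestone : pred nat;
  net : nat -> {set digits d e};
  columns : nat -> {set digits d e};
  mult : nat -> nat;
  ladder_patterns : forall n, pattern_pair (mult n) (net n) (columns n);
  ladder_mult : forall n, 0 < mult n;
  ladder_base : 1 < e }.

(** At a milestone all cells are treated alike, so that the type of the parent is
    forgotten there and the child at [ladder_digit] starts a bundle of columns. *)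
Fixpoint in_column d e (S : ladder d e) (n : nat) (p : cell d) : bool :=
  if n is n'.+1 then
    if milestone S n' then digit e p == ladder_digit d e
    else in_column S n' (parent e p)
  else false.

Definition pattern d e (S : ladder d e) n (p : cell d) : {set digits d e} :=
  if milestone S n || ~~ in_column S n p then net S n else columns S n.

Fixpoint cells d e (S : ladder d e) n : seq (cell d) :=
  if n is n'.+1 then
    [seq child p a | p <- cells S n', a <- enum (pattern S n' p)]
  else [:: [ffun => 0]].

Section CellIndex.
Variables d e : nat.
Implicit Types (p q : cell d) (a : digits d e).

Lemma val_digit p i : digit e p i = p i %% e.+1 :> nat.
Proof. by rewrite ffunE inordK // ltn_mod. Qed.

Lemma parent_child p a : parent e (child p a) = p.
Proof. by apply/ffunP=> i; rewrite !ffunE divnMDl // divn_small ?addn0. Qed.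

Lemma digit_child p a : digit e (child p a) = a.
Proof.
by apply/ffunP=> i; apply: val_inj; rewrite /= val_digit ffunE modnMDl modn_small.
Qed.

Lemma child_parent p : child (parent e p) (digit e p) = p.
Proof. by apply/ffunP=> i; rewrite ffunE val_digit ffunE -divn_eq. Qed.

Lemma ancestor0 p : ancestor e 0 p = p.
Proof. by apply/ffunP=> i; rewrite ffunE divn1. Qed.

Lemma ancestorD j k p : ancestor e (j + k) p = ancestor e j (ancestor e k p).
Proof. by apply/ffunP=> i; rewrite !ffunE -divnMA expnD mulnC. Qed.

Lemma ancestor1 p : ancestor e 1 p = parent e p.
Proof. by apply/ffunP=> i; rewrite !ffunE expn1. Qed.

Lemma ancestorS k p : ancestor e k.+1 p = ancestor e k (parent e p).
Proof. by rewrite -addn1 ancestorD ancestor1. Qed.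

Lemma ancestorSr k p : ancestor e k.+1 p = parent e (ancestor e k p).
Proof. by rewrite -add1n ancestorD ancestor1. Qed.

End CellIndex.

Section Cells.
Variables (d e : nat) (S : ladder d e).
Implicit Types (p q : cell d) (a : digits d e).

Lemma mem_cells n p : (p \in cells S n.+1) =
  (parent e p \in cells S n) && (digit e p \in pattern S n (parent e p)).
Proof.
apply/allpairsPdep/andP => [[q [a [qn aq ->]]]|[pn dp]].
  by rewrite parent_child digit_child; rewrite mem_enum in aq.
by exists (parent e p), (digit e p); rewrite mem_enum child_parent.
Qed.

Lemma cells_uniq n : uniq (cells S n).
Proof.
elim: n => // n IH; apply: allpairs_uniq_dep => [|p _|]; [exact: IH|exact: enum_uniq|].
move=> [p a] [q b] _ _ /= E.
have pq : p = q by rewrite -(parent_child p a) E parent_child.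
have ab : a = b by rewrite -(digit_child p a) E digit_child.
by rewrite pq ab.
Qed.

Lemma cells_ancestor n k p : p \in cells S (n + k) -> ancestor e k p \in cells S n.
Proof.
elim: k p => [|k IH] p; first by rewrite addn0 ancestor0.
by rewrite addnS mem_cells ancestorS => /andP[/IH].
Qed.

Lemma card_pattern n p : #|pattern S n p| = e.+1 * mult S n.
Proof.
rewrite /pattern; case: ifP => _; first exact: (card_connected (ladder_patterns S n)).
exact: (card_columns (ladder_patterns S n)).
Qed.

Lemma count_cells n (F : cell d -> pred (digits d e)) :
  count (fun p => F (parent e p) (digit e p)) (cells S n.+1) =
  \sum_(p <- cells S n) #|[set a in pattern S n p | F p a]|.
Proof.
rewrite /= count_flatten -map_comp sumnE big_map; apply: eq_bigr => p _ /=.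
rewrite count_map (eq_count (a2 := F p)) => [|a] /=; last by rewrite parent_child digit_child.
rewrite cardE -size_filter; apply/perm_size/uniq_perm; rewrite ?enum_uniq ?(filter_uniq _ (enum_uniq _)) //.
by move=> a; rewrite mem_filter !mem_enum inE andbC.
Qed.

Lemma count_parent n (Q : pred (cell d)) :
  count (fun p => Q (parent e p)) (cells S n.+1) =
  (e.+1 * mult S n) * count Q (cells S n).
Proof.
rewrite (count_cells n (fun p _ => Q p)) -sum1_count big_distrr /= [RHS]big_mkcond.
apply: eq_bigr => p _; case Qp: (Q p).
  rewrite muln1 -(card_pattern n p); apply: eq_card => a; by rewrite inE andbT.
by apply: eq_card0 => a; rewrite inE andbF.
Qed.

Lemma size_cellsS n : size (cells S n.+1) = (e.+1 * mult S n) * size (cells S n).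
Proof. by rewrite -!(count_predT (cells S _)) -count_parent. Qed.

(** The number of descendants of a cell depends on its level only. *)
Lemma count_ancestor n k (Q : pred (cell d)) :
  count (fun p => Q (ancestor e k p)) (cells S (n + k)) * size (cells S n) =
  size (cells S (n + k)) * count Q (cells S n).
Proof.
elim: k => [|k IH].
  rewrite addn0 mulnC; congr (_ * _); apply: eq_count => p; by rewrite ancestor0.
rewrite addnS size_cellsS -mulnA -IH mulnA -count_parent; congr (_ * _).
by apply: eq_count => p; rewrite ancestorS.
Qed.

(** ** Adjacency *)

(** Closed cubes of the same level touch exactly when their indices are adjacent. *)
Definition adj p q := [forall i, (p i <= (q i).+1) && (q i <= (p i).+1)].

Lemma adj_refl p : adj p p.
Proof. by apply/forallP=> i; rewrite leqnSn. Qed.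

Lemma adj_sym p q : adj p q = adj q p.
Proof. by apply: eq_forallb => i; rewrite andbC. Qed.

Inductive linked (D : pred (cell d)) (p : cell d) : cell d -> Prop :=
| LinkedRefl : D p -> linked D p p
| LinkedStep q r : linked D p q -> adj q r -> D r -> linked D p r.

Lemma linked_trans D p q r : linked D p q -> linked D q r -> linked D p r.
Proof. by move=> pq; elim=> // u v _ pu uv Dv; apply: LinkedStep uv Dv. Qed.

Lemma linked_dom D p q : linked D p q -> D p /\ D q.
Proof. by elim=> // u v _ [Dp _]. Qed.

Lemma linked_sym D p q : linked D p q -> linked D q p.
Proof.
elim=> [Dp|u v pu up uv Dv]; first exact: LinkedRefl.
apply: linked_trans up; have [_ Du] := linked_dom pu.
by apply: LinkedStep (LinkedRefl _) _ _; rewrite // adj_sym.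
Qed.

Lemma linked_mono (D D' : pred (cell d)) p q :
  {subset D <= D'} -> linked D p q -> linked D' p q.
Proof.
move=> DD'; elim=> [Dp|u v _ pu uv Dv]; first by apply: LinkedRefl; apply: DD'.
by apply: LinkedStep uv _ => //; apply: DD'.
Qed.

(** Connectivity passes from one level to the next once the children of each cell
    are linked and touching cells have touching children: follow the path of
    parents. *)
Lemma linked_lift (D D' : pred (cell d)) (f : cell d -> cell d) :
  (forall p q, D' p -> D' q -> D (f p) -> f p = f q -> linked D' p q) ->
  (forall u v, D u -> D v -> adj u v ->
     exists p q, [/\ D' p, D' q, f p = u, f q = v & adj p q]) ->
  forall p q, D' p -> D' q -> linked D (f p) (f q) -> linked D' p q.
Proof.
move=> Hfib Hadj p q D'p D'q.
move E : (f q) => v pv.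
elim: pv q D'q E => [Dp|w x pw IH wx Dx] q D'q E; first exact: Hfib.
have [_ Dw] := linked_dom pw.
have [w' [v' [D'w' D'v' fw fv wv']]] := Hadj _ _ Dw Dx wx.
apply: linked_trans (LinkedStep (IH _ D'w' fw) wv' D'v') _.
by apply: Hfib; rewrite // fv.
Qed.

(** Induction on the sum of the digits, which [retract] decreases. *)
Lemma linked_retract (D : pred (cell d)) u (Q : pred (digits d e)) :
  (forall a, Q a -> D (child u a)) ->
  (forall a, Q a -> a != [ffun => ord0] -> Q (retract a)) ->
  forall a, Q a -> linked D (child u a) (child u ([ffun => ord0] : digits d e)).
Proof.
move=> DQ Qr a; have [r] := ubnP (\sum_i (a i : nat)).
elim: r a => // r IH a ar Qa.
case: (eqVneq a [ffun => ord0]) => [az|anz].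
  by rewrite -az; apply/LinkedRefl/DQ.
have Qra := Qr a Qa anz; apply: linked_sym.
apply: (LinkedStep (q := child u (retract a))) (DQ _ Qa).
  apply/linked_sym/IH; last exact: Qra.
  exact: leq_trans (retract_rank anz) ar.
apply/forallP=> i; rewrite !ffunE; have /andP[] := retract_adj a i; lia.
Qed.


(** ** Chains of touching cells between milestones *)

Lemma corner_neq_ladder a : corner a -> a != ladder_digit d e.
Proof.
move=> /forallP ca; apply/eqP => E; have := ca ord0; rewrite E ffunE eqxx.
have e1 := ladder_base S.
by case/orP=> /eqP/(congr1 val); rewrite /= inordK //; lia.
Qed.

Definition plain n p := (p \in cells S n) && ~~ in_column S n p.

(** The cells whose children form a net. *)
Definition net_cell n p := (p \in cells S n) && (milestone S n || ~~ in_column S n p).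

Lemma corner_plain n p a : net_cell n p -> corner a -> plain n.+1 (child p a).
Proof.
move=> /andP[pn tp] ca; rewrite /plain mem_cells /= parent_child digit_child pn.
have HP := ladder_patterns S n.
rewrite /pattern tp (connected_corner HP ca) /=; case: (milestone S n) tp => //= _.
exact: corner_neq_ladder.
Qed.

(** Touching cells share a vertex. The children at that vertex exist, since nets
    contain all corners, and touch again; as they are plain, this can be repeated. *)
Lemma adj_children n p q : net_cell n p -> net_cell n q -> adj p q ->
  exists p' q', [/\ plain n.+1 p', plain n.+1 q', parent e p' = p, parent e q' = q & adj p' q'].
Proof.
move=> pn qn /forallP pq.
pose a p q : digits d e := [ffun i => if p i < q i then ord_max else ord0].
have ca x y : corner (a x y) by apply/forallP=> i; rewrite ffunE; case: ifP; rewrite eqxx ?orbT.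
exists (child p (a p q)), (child q (a q p)); rewrite !parent_child; split=> //.
- exact: corner_plain.
- exact: corner_plain.
- apply/forallP=> i; rewrite !ffunE; have /andP[] := pq i.
  by case: ltngtP => /= [||->]; nia.
Qed.

Lemma net_of_plain n p : plain n p -> net_cell n p.
Proof. by case/andP=> pn tp; rewrite /net_cell pn tp orbT. Qed.

Lemma adj_descendants n k p q : (forall j, 0 < j < k -> ~~ milestone S (n + j)) ->
  net_cell n p -> net_cell n q -> adj p q ->
  exists p' q', [/\ net_cell (n + k) p', net_cell (n + k) q',
    ancestor e k p' = p, ancestor e k q' = q & adj p' q'].
Proof.
move=> Hm pn qn pq; elim: k Hm => [|k IH] Hm.
  by exists p, q; rewrite addn0 !ancestor0.
have [|p1 [q1 [p1n q1n <- <- pq1]]] := IH.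
  by move=> j /andP[j0 jk]; apply: Hm; rewrite j0 ltnW.
have [p2 [q2 [p2n q2n <- <- pq2]]] := adj_children p1n q1n pq1.
by exists p2, q2; rewrite addnS !ancestorS; split=> //; apply: net_of_plain.
Qed.

Section Descendants.
Variables (n k : nat) (u : cell d).
Hypotheses (mn : milestone S n) (un : u \in cells S n).
Hypothesis (Hm : forall j, 0 < j < k.+1 -> ~~ milestone S (n + j)).

Definition plain_below j : pred (cell d) :=
  fun p => plain (n + j) p && (ancestor e j p == u).

Definition below j : pred (cell d) :=
  fun p => (p \in cells S (n + j)) && (ancestor e j p == u).

Lemma plain_belowW j : {subset plain_below j <= below j}.
Proof. by move=> p /andP[/andP[pn _] pu]; apply/andP. Qed.

Lemma net_retract m a : a \in net S m -> a != ladder_digit d e ->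
  (retract a \in net S m) && (retract a != ladder_digit d e).
Proof.
move=> aN aell; rewrite (connected_retract (ladder_patterns S m)) //=.
by apply: retract_neq_ladder; have := ladder_base S; lia.
Qed.

(** The ladder digit, to which [retract] does not apply, touches the corner just below. *)
Lemma net_linked (D : pred (cell d)) m v a :
  (forall a, a \in net S m -> D (child v a)) -> a \in net S m ->
  linked D (child v a) (child v ([ffun => ord0] : digits d e)).
Proof.
move=> HD; pose Q a := (a \in net S m) && (a != ladder_digit d e).
have link b : Q b -> linked D (child v b) (child v ([ffun => ord0] : digits d e)).
  apply: linked_retract => [{}b /andP[bN _]|{}b /andP[bN bell] _]; first exact: HD.
  exact: net_retract.
case: (eqVneq a (ladder_digit d e)) => [-> _|aell aN]; last by apply: link; apply/andP.
pose f := set_height (ladder_digit d e) ord0.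
have fc : corner f.
  by apply/forallP=> i; rewrite !ffunE; case: (i == ord0); rewrite ?eqxx ?orbT.
have fN : f \in net S m by apply: (connected_corner (ladder_patterns S m)).
apply: linked_trans (link f _); last by rewrite /Q fN corner_neq_ladder.
have lN := connected_ladder (ladder_patterns S m).
apply: LinkedStep (LinkedRefl (HD _ lN)) _ (HD _ fN).
apply/forallP=> i; rewrite !ffunE; case: (i == ord0); last by rewrite leqnSn.
have e1 := ladder_base S; rewrite inordK /=; lia.
Qed.

Lemma plain_below_linked j p q : j <= k ->
  plain_below j.+1 p -> plain_below j.+1 q -> linked (plain_below j.+1) p q.
Proof.
elim: j p q => [|j IH] p q jk Hp Hq.
  pose Q a := (a \in net S n) && (a != ladder_digit d e).
  have QD a : Q a -> plain_below 1 (child u a).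
    move=> /andP[aN aell]; rewrite /plain_below /plain addn1 mem_cells /= ancestor1.
    by rewrite parent_child digit_child un mn aell eqxx /pattern mn aN.
  have Qr a : Q a -> a != [ffun => ord0] -> Q (retract a).
    by move=> /andP[aN aell] _; apply: net_retract.
  have linkp r : plain_below 1 r -> linked (plain_below 1) r (child u ([ffun => ord0] : digits d e)).
    move=> Hr; have [dr cr ru] : [/\ digit e r \in net S n,
        digit e r != ladder_digit d e & parent e r = u].
      move: Hr; rewrite /plain_below /plain addn1 mem_cells ancestor1 /= mn /=.
      by rewrite /pattern mn => /andP[/andP[/andP[_ dr] cr] /eqP ru].
    rewrite -(child_parent e r) ru; apply: (linked_retract QD Qr).
    exact/andP.
  exact: linked_trans (linkp p Hp) (linked_sym (linkp q Hq)).
have nm : ~~ milestone S (n + j.+1) by apply: Hm; lia.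
have Hup r : plain_below j.+2 r -> plain_below j.+1 (parent e r) /\
    digit e r \in net S (n + j.+1).
  rewrite /plain_below /plain (addnS n j.+1) mem_cells /= (negbTE nm) ancestorS.
  by rewrite /pattern => /andP[/andP[/andP[-> +] tr] ->]; rewrite tr orbT.
refine (linked_lift (D := plain_below j.+1) (f := @parent e d) _ _ Hp Hq _); last first.
- by apply: IH; [exact: ltnW| |]; apply: (Hup _ _).1.
- move=> v w /andP[vn /eqP vu] /andP[wn /eqP wu] vw.
  have [v' [w' [v'n w'n vv' ww' vw']]] := adj_children (net_of_plain vn) (net_of_plain wn) vw.
  exists v', w'; split=> //; rewrite /plain_below (addnS n j.+1).
    by rewrite v'n ancestorS vv' vu eqxx.
  by rewrite w'n ancestorS ww' wu eqxx.
move=> {Hp Hq}p {}q Hp Hq Hfp fpq.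
have D' a : a \in net S (n + j.+1) -> plain_below j.+2 (child (parent e p) a).
  move: Hfp => /andP[/andP[pn tp] /eqP pu] aN.
  rewrite /plain_below /plain (addnS n j.+1) mem_cells /= (negbTE nm) ancestorS.
  by rewrite parent_child digit_child pn tp pu eqxx /pattern tp orbT aN.
have [_ dp] := Hup p Hp; have [_ dq] := Hup q Hq.
have := linked_trans (net_linked D' dp) (linked_sym (net_linked D' dq)).
by rewrite child_parent fpq child_parent.
Qed.

Definition at_height p y : cell d := [ffun i => if i == ord0 then y else p i].

Lemma digit_at_height p y : digit e (at_height p y) = set_height (digit e p) (inord (y %% e.+1)).
Proof. by apply/ffunP=> i; rewrite !ffunE; case: eqP. Qed.

Lemma parent_at_height p y : parent e (at_height p y) = at_height (parent e p) (y %/ e.+1).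
Proof. by apply/ffunP=> i; rewrite !ffunE; case: eqP. Qed.

Lemma at_height_id p : at_height p (p ord0) = p.
Proof. by apply/ffunP=> i; rewrite !ffunE; case: eqP => [->|]. Qed.

Definition column_cell m p := (p \in cells S m) && in_column S m p.

Lemma column_parent m p : ~~ milestone S m -> column_cell m.+1 p ->
  column_cell m (parent e p) /\ digit e p \in columns S m.
Proof.
move=> /negbTE nm; rewrite /column_cell mem_cells /= nm => /andP[/andP[pm +] tp].
by rewrite pm tp /pattern nm tp.
Qed.

Lemma column_child m p : ~~ milestone S m -> column_cell m (parent e p) ->
  digit e p \in columns S m -> column_cell m.+1 p.
Proof.
move=> /negbTE nm; rewrite /column_cell mem_cells /= nm => /andP[-> tp].
by rewrite tp /pattern nm tp => ->.
Qed.

(** The vertical digits of a column cell are free within its bundle. *)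
Lemma column_move j p y : j <= k -> column_cell (n + j.+1) p ->
  y %/ e.+1 ^ j = p ord0 %/ e.+1 ^ j -> column_cell (n + j.+1) (at_height p y).
Proof.
elim: j p y => [|j IH] p y jk pn; first by rewrite !divn1 => ->; rewrite at_height_id.
have nm : ~~ milestone S (n + j.+1) by apply: Hm; lia.
rewrite expnS !divnMA => E; move: pn; rewrite addnS => pn.
have [pp dp] := column_parent nm pn; apply: column_child => //.
  by rewrite parent_at_height; apply: IH => //; [exact: ltnW|rewrite ffunE].
by rewrite digit_at_height (column_vertical (ladder_patterns S _)).
Qed.

(** A bundle stands on the cell below its root: the root has vertical digit 1, so that
    this cell is the corner of the net under it. Inside that corner cell, the cells just
    below the columns are tops of columns, which nets contain by [connected_top]. *)
Lemma column_foot j p : j <= k -> column_cell (n + j.+1) p ->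
  (p ord0 %/ e.+1 ^ j) %% e.+1 = 1 /\
  plain (n + j.+1) (at_height p ((p ord0 %/ e.+1 ^ j) * e.+1 ^ j).-1).
Proof.
have e1 := ladder_base S.
elim: j p => [|j IH] p jk.
  rewrite addn1 /column_cell mem_cells /= mn muln1 divn1 => /andP[/andP[pn _] /eqP dp].
  have p01 : p ord0 %% e.+1 = 1 by rewrite -val_digit dp ffunE eqxx inordK // ltnS ltnW.
  split=> //; rewrite -(child_parent e (at_height _ _)); apply: corner_plain.
    rewrite /net_cell mn andbT parent_at_height.
    suff -> : (p ord0).-1 %/ e.+1 = parent e p ord0 by rewrite at_height_id.
    by rewrite ffunE {1}(divn_eq (p ord0) e.+1) p01 addn1 /= mulnK.
  rewrite digit_at_height dp; apply/forallP=> i; rewrite !ffunE.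
  case: (i == ord0); last by rewrite eqxx orbT.
  rewrite {1 2}(divn_eq (p ord0) e.+1) p01 addn1 /= modnMl; apply/orP; left.
  by apply/eqP/val_inj; rewrite /= inordK.
have nm : ~~ milestone S (n + j.+1) by apply: Hm; lia.
rewrite addnS => pn; have [pp dp] := column_parent nm pn.
have [] := IH (parent e p) (ltnW jk) pp; rewrite ffunE -divnMA -expnS.
set x := p ord0 %/ _ => x1 qn; split=> //.
have x0 : 0 < x by case: x x1 {qn} => //; rewrite mod0n.
have E : x * e.+1 ^ j.+1 = (x * e.+1 ^ j).-1 * e.+1 + e.+1.
  by rewrite -[X in _ + X]mul1n -mulnDl addn1 prednK ?muln_gt0 ?x0 ?expn_gt0 // expnSr mulnA.
rewrite /plain mem_cells /= (negbTE nm) parent_at_height digit_at_height E addnS /=.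
rewrite divnMDl // modnMDl divn_small // modn_small // addn0.
have /andP[-> tq] := qn; rewrite tq /pattern tq orbT /= andbT.
have -> : inord e = ord_max :> 'I_e.+1 by apply: val_inj; rewrite /= inordK.
exact: (connected_top (ladder_patterns S _)).
Qed.

(** Each cell of a bundle descends along its column to a plain cell, and plain cells
    are linked to one another. *)
Lemma below_linked p q : below k.+1 p -> below k.+1 q -> linked (below k.+1) p q.
Proof.
have foot r : below k.+1 r -> exists2 r', plain_below k.+1 r' & linked (below k.+1) r r'.
  move=> /andP[rn ru].
  case tr: (in_column S (n + k.+1) r); last first.
    by exists r; [|apply: LinkedRefl]; rewrite /plain_below /plain /below rn ?tr ru.
  have cr : column_cell (n + k.+1) r by rewrite /column_cell rn.
  have [] := column_foot (leqnn k) cr; set b := e.+1 ^ k; set x := r ord0 %/ b => x1 pl.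
  have b0 : 0 < b by rewrite expn_gt0.
  have x0 : 0 < x by case: x x1 {pl} => //; rewrite mod0n.
  have below_at y : at_height r y \in cells S (n + k.+1) ->
      y %/ b %/ e.+1 = x %/ e.+1 -> below k.+1 (at_height r y).
    move=> yn E; rewrite /below yn -(eqP ru) /=; apply/eqP/ffunP=> i; rewrite !ffunE.
    by case: eqP => // ->; rewrite expnSr !divnMA.
  have plf : plain_below k.+1 (at_height r (x * b).-1).
    have /andP[fn _] := pl; rewrite /plain_below pl /=.
    have /andP[] // : below k.+1 (at_height r (x * b).-1); apply: below_at => //.
    have xE : x = x %/ e.+1 * e.+1 + 1 by rewrite -x1 -divn_eq.
    have -> : (x * b).-1 = (x %/ e.+1 * e.+1) * b + b.-1.
      by rewrite {1}xE mulnDl mul1n -!subn1 addnBA.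
    by rewrite divnMDl // (@divn_small b.-1 b) ?prednK // addn0 mulnK.
  have up y : x * b + y <= r ord0 -> linked (below k.+1) (at_height r (x * b).-1) (at_height r (x * b + y)).
    have bel y' : x * b + y' <= r ord0 -> below k.+1 (at_height r (x * b + y')).
      move=> yr; have E : (x * b + y') %/ b = x.
        rewrite divnMDl // divn_small ?addn0 // -(ltn_add2l (x * b)) (leq_ltn_trans yr) //.
        by rewrite {1}(divn_eq (r ord0) b) ltn_add2l ltn_mod.
      apply: below_at; last by rewrite E.
      by have /andP[] := column_move (leqnn k) cr E.
    have step z z' : z <= z'.+1 -> z' <= z.+1 -> adj (at_height r z) (at_height r z').
      by move=> zz' z'z; apply/forallP=> i; rewrite !ffunE; case: eqP; rewrite ?zz' ?z'z ?leqnSn.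
    elim: y => [|y IH] yr.
      apply: LinkedStep (LinkedRefl (plain_belowW plf)) _ (bel _ yr).
      by apply: step; rewrite addn0 ?leqSpred // (leq_trans (leq_pred _)).
    have yr' : x * b + y <= r ord0 by rewrite (leq_trans _ yr) // addnS.
    apply: LinkedStep (IH yr') _ (bel _ yr).
    by apply: step; rewrite addnS // ltnW.
  exists (at_height r (x * b).-1) => //; apply: linked_sym.
  have := up (r ord0 %% b); rewrite -divn_eq at_height_id; exact.
move=> /foot[p' p'n pp'] /foot[q' q'n qq'].
apply: linked_trans pp' (linked_trans _ (linked_sym qq')).
exact: linked_mono (@plain_belowW _) (plain_below_linked (leqnn k) p'n q'n).
Qed.

End Descendants.
End Cells.

(** * Nested walks through the cells *)

Section Walks.
Variables (d e : nat) (S : ladder d e).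
Implicit Types (p q u v : cell d) (D : pred (cell d)).

Lemma linked_path D p q : linked D p q ->
  exists s, [/\ path (@adj d) p s, last p s = q & all D s].
Proof.
elim=> [Dp|u v pu [s [ps ls Ds]] uv Dv]; first by exists [::].
exists (rcons s v); rewrite rcons_path last_rcons all_rcons ps ls uv Ds Dv.
by split.
Qed.

Lemma tour D p q (l : seq (cell d)) : (forall u v, D u -> D v -> linked D u v) ->
  D p -> D q -> all D l ->
  exists s, [/\ path (@adj d) p s, last p s = q, all D s & {subset l <= p :: s}].
Proof.
move=> HD; elim: l p => [|u l IH] p Dp Dq.
  by have [s [ps ls Ds]] := linked_path (HD _ _ Dp Dq); exists s.
move=> /= /andP[Du Dl]; have [s [ps ls Ds]] := linked_path (HD _ _ Dp Du).
have [t [pt lt Dt sub]] := IH u Du Dq Dl.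
exists (s ++ t); rewrite cat_path last_cat all_cat ps Ds ls pt lt Dt; split=> // x.
rewrite inE => /orP[/eqP->|/sub]; rewrite !(inE, mem_cat).
  by have := mem_last p s; rewrite ls inE => /orP[->|->] //; rewrite orbT.
case/orP=> [/eqP->|->]; last by rewrite !orbT.
by have := mem_last p s; rewrite ls inE => /orP[->|->] //; rewrite orbT.
Qed.

(** A tour is lengthened by waiting at its start. All tours can thus be given the
    same length, which the refinement of walks requires. *)
Lemma long_tour D p q (l : seq (cell d)) : (forall u v, D u -> D v -> linked D u v) ->
  D p -> D q -> all D l ->
  exists L0, forall L, L0 <= L -> exists s,
    [/\ path (@adj d) p s, last p s = q, all D s, {subset l <= p :: s} & size s = L].
Proof.
move=> HD Dp Dq Dl; have [s [ps ls Ds sub]] := tour HD Dp Dq Dl.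
exists (size s) => L sL; exists (nseq (L - size s) p ++ s).
have pn k : path (@adj d) p (nseq k p) by elim: k => //= k ->; rewrite adj_refl.
have ln k : last p (nseq k p) = p by elim: k.
rewrite cat_path last_cat all_cat ln pn ps ls Ds all_nseq Dp orbT size_cat size_nseq subnK //.
split=> // x /sub; rewrite !(inE, mem_cat) => /orP[->//|->]; by rewrite !orbT.
Qed.

(** Each step of [w] is replaced by a block of exactly [L] steps below it, so that
    position [j] of the finer walk lies under position [j %/ L] of [w]. *)
Definition refines (k L : nat) (w w' : seq (cell d)) :=
  size w' = L * size w /\
  forall j, j < size w' ->
    ancestor e k (nth [ffun => 0] w' j) = nth [ffun => 0] w (j %/ L).

(** Each block is a tour of the cells below the current one, ending at a cell that
    touches the first cell of the next block. The length of the blocks is a free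
    large parameter, so that the induction can give the same length to all. *)
Lemma refine_walk n k v w a : milestone S n -> milestone S (n + k.+1) ->
  (forall j, 0 < j < k.+1 -> ~~ milestone S (n + j)) ->
  path (@adj d) v w -> all [in cells S n] (v :: w) ->
  a \in cells S (n + k.+1) -> ancestor e k.+1 a = v ->
  exists L0, forall L, L0 <= L -> exists s,
    [/\ path (@adj d) a s, all [in cells S (n + k.+1)] s,
        refines k.+1 L.+1 (v :: w) (a :: s) &
        forall p, p \in cells S (n + k.+1) -> ancestor e k.+1 p \in v :: w -> p \in a :: s].
Proof.
move=> mn mn' Hm; elim: w v a => [|u w IH] v a.
  move=> _ /= /andP[vn _] an av.
  have lk := below_linked mn vn Hm.
  have Da : below S n v k.+1 a by rewrite /below an av eqxx.
  have Dl : all (below S n v k.+1) [seq p <- cells S (n + k.+1) | ancestor e k.+1 p == v].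
    by apply/allP=> p; rewrite mem_filter /below andbC.
  have [L0 HL] := long_tour lk Da Da Dl; exists L0 => L /HL[s [ps ls Ds sub sz]].
  exists s; split=> //.
  - by apply: sub_all Ds => p /andP[].
  - split=> [|j]; rewrite /= sz ?muln1 // => jL; rewrite divn_small //=.
    have /allP/(_ _ (mem_nth [ffun => 0] (s := a :: s) (n := j) _)) : all (below S n v k.+1) (a :: s).
      by rewrite /= Da Ds.
    by rewrite /= sz => /(_ jL)/andP[_ /eqP].
  - by move=> p pn; rewrite inE => /eqP pv; apply: sub; rewrite mem_filter pv eqxx.
move=> /= /andP[vu uw] /and3P[vn un wn] an av.
have vnet : net_cell S n v by rewrite /net_cell vn mn.
have unet : net_cell S n u by rewrite /net_cell un mn.
have [z [b [/andP[zn _] /andP[bn _] zv bu zb]]] := adj_descendants Hm vnet unet vu.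
have [|L1 HL1] := IH u b uw _ bn bu; first by rewrite /= un wn.
have lk := below_linked mn vn Hm.
have Da : below S n v k.+1 a by rewrite /below an av eqxx.
have Dz : below S n v k.+1 z by rewrite /below zn zv eqxx.
have Dl : all (below S n v k.+1) [seq p <- cells S (n + k.+1) | ancestor e k.+1 p == v].
  by apply/allP=> p; rewrite mem_filter /below andbC.
have [L0 HL0] := long_tour lk Da Dz Dl; exists (maxn L0 L1) => L.
rewrite geq_max => /andP[/HL0[s [ps ls Ds sub sz]] /HL1[t [pt Dt [szt nt] subt]]].
exists (s ++ b :: t); split.
- by rewrite cat_path ps ls /= zb.
- by rewrite all_cat /= bn Dt !andbT; apply/allP => p /(allP Ds)/andP[].
- split=> [|j jL]; first by rewrite /= size_cat /= sz -addSn; move: szt => /= ->; rewrite [RHS]mulnS.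
  rewrite -cat_cons nth_cat /= sz; case: ltnP => jL1.
    rewrite divn_small //=.
    have /allP/(_ _ (mem_nth [ffun => 0] (s := a :: s) (n := j) _)) : all (below S n v k.+1) (a :: s).
      by rewrite /= Da Ds.
    by rewrite /= sz => /(_ jL1)/andP[_ /eqP].
  have jt : j - L.+1 < size (b :: t).
    by rewrite ltn_subLR //; move: jL; rewrite /= size_cat /= sz addSn.
  rewrite (nt _ jt) -[in RHS](subnK jL1) divnDr ?dvdnn // divnn /=.
  by rewrite addn1.
- move=> p pn; rewrite inE => /orP[/eqP pv|pw].
    have := sub p; rewrite mem_filter pv eqxx pn => /(_ isT).
    by rewrite !inE mem_cat => /orP[->//|->]; rewrite !orbT.
  by rewrite -cat_cons mem_cat (subt p pn pw) orbT.
Qed.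

Definition full_walk n w :=
  [/\ w != [::], sorted (@adj d) w, all [in cells S n] w & {subset cells S n <= w}].

Lemma refine_full n k w : milestone S n -> milestone S (n + k.+1) ->
  (forall j, 0 < j < k.+1 -> ~~ milestone S (n + j)) -> full_walk n w ->
  exists w' L, [/\ full_walk (n + k.+1) w', 0 < L & refines k.+1 L w w'].
Proof.
move=> mn mn' Hm [+ + + sub]; case: w sub => // v w sub _ vw vwn.
have vn : v \in cells S n by case/andP: vwn.
have vnet : net_cell S n v by rewrite /net_cell vn mn.
have [a [_ [/andP[an _] _ av _ _]]] := adj_descendants Hm vnet vnet (adj_refl v).
have [L0 /(_ L0 (leqnn _))[s [ps Ds rs subs]]] := refine_walk mn mn' Hm vw vwn an av.
exists (a :: s), L0.+1; split=> //; split=> //; first by rewrite /= an.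
by move=> p pn; apply: subs => //; apply: sub; apply: cells_ancestor.
Qed.

Lemma nested_walks (T k : nat -> nat) : T 0 = 0 ->
  (forall i, T i.+1 = T i + (k i).+1) -> (forall i, milestone S (T i)) ->
  (forall i j, 0 < j < (k i).+1 -> ~~ milestone S (T i + j)) ->
  exists (w : nat -> seq (cell d)) (L : nat -> nat), forall i,
    [/\ full_walk (T i) (w i), 0 < L i & refines (k i).+1 (L i) (w i) (w i.+1)].
Proof.
move=> T0 TS mT nmT.
have next i (w : {w | full_walk (T i) w}) : {w' : {w' | full_walk (T i.+1) w'} |
    exists2 L, 0 < L & refines (k i).+1 L (sval w) (sval w')}.
  apply: cid; case: w => w /= ww.
  have := mT i.+1; rewrite TS => mT'.
  have [w' [L [fw' L0 rw']]] := refine_full (mT i) mT' (nmT i) ww.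
  by exists (exist _ w' fw'); exists L.
have w0 : full_walk (T 0) [:: [ffun => 0]].
  by rewrite T0; split=> //=; rewrite ?inE ?eqxx.
pose W := nat_rect (fun i => {w | full_walk (T i) w}) (exist _ _ w0)
  (fun i w => sval (next i w)).
have HL i : exists L, 0 < L /\ refines (k i).+1 L (sval (W i)) (sval (W i.+1)).
  by have [L L0 HL] := svalP (next i (W i)); exists L.
have [L {}HL] := choice HL.
exists (fun i => sval (W i)), L => i; have [L0 r] := HL i; split=> //.
exact: (svalP (W i)).
Qed.

End Walks.

(** * Counting cells *)

Section Counts.
Variables (d e : nat) (S : ladder d e).
Implicit Types (p q u v : cell d).

Lemma size_cells_gt0 n : (0 < size (cells S n))%N.
Proof.
by elim: n => // n IH; rewrite size_cellsS !muln_gt0 IH (ladder_mult S n).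
Qed.

Lemma count_descendants n k u :
  (count (fun p => ancestor e k p == u) (cells S (n + k)) * size (cells S n) =
   size (cells S (n + k)) * (u \in cells S n))%N.
Proof.
rewrite (count_ancestor S n k (pred1 u)); congr (_ * _)%N.
by rewrite count_uniq_mem // cells_uniq.
Qed.

(** At most [3 ^ d.+2] cells touch [u], and each has the same number of descendants. *)
Lemma count_near n k u :
  (count (fun p => adj u (ancestor e k p)) (cells S (n + k)) * size (cells S n)
   <= 3 ^ d.+2 * size (cells S (n + k)))%N.
Proof.
pose near (f : {ffun 'I_d.+2 -> 'I_3}) : cell d := [ffun i => (u i + f i).-1].
have -> : (3 ^ d.+2 = #|{ffun 'I_d.+2 -> 'I_3}|)%N by rewrite card_ffun !card_ord.
apply: leq_trans (_ : \sum_(f : {ffun 'I_d.+2 -> 'I_3})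
    count (fun p => ancestor e k p == near f) (cells S (n + k)) * size (cells S n) <= _)%N.
  rewrite -big_distrl leq_mul2r; apply/orP; right; rewrite -sum1_count big_mkcond /=.
  under [leqRHS]eq_bigr do rewrite -sum1_count big_mkcond.
  rewrite exchange_big /=; apply: leq_sum => p _; case: ifP => // /forallP up.
  pose f : {ffun 'I_d.+2 -> 'I_3} := [ffun i => inord ((ancestor e k p i).+1 - u i)].
  rewrite (bigD1 f) //= ifT ?leq_addr //; apply/eqP/ffunP=> i.
  by have /andP[] := up i; rewrite !ffunE; move: (p i %/ _)%N => m lo hi; rewrite inordK; lia.
rewrite -sum1_card big_distrl /= leq_sum // => f _; rewrite count_descendants mul1n.
by case: (_ \in _); rewrite ?muln1 ?muln0.
Qed.

End Counts.

Local Open Scope classical_set_scope.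
Local Open Scope ring_scope.

(** * The limit set *)


Section Cubes.
Variables (R : realType) (d e : nat).
Implicit Types (p q u v : cell d) (x y : 'rV[R]_d.+2).

Definition cube n p : set 'rV[R]_d.+2 :=
  [set x | forall i, (p i)%:R <= x 0 i * e.+1%:R ^+ n <= (p i).+1%:R].

Lemma base_gt0 n : 0 < e.+1%:R ^+ n :> R.
Proof. exact: exprn_gt0. Qed.

Lemma cube_ancestor n k p x : cube (n + k) p x -> cube n (ancestor e k p) x.
Proof.
move=> px i; have /andP[lo hi] := px i.
have B0 := base_gt0 k; rewrite exprD mulrA in lo hi.
rewrite ffunE; apply/andP; split; rewrite -(ler_pM2r B0).
  by apply: le_trans _ lo; rewrite -natrX -natrM ler_nat leq_trunc_div.
by apply: le_trans hi _; rewrite -natrX -natrM ler_nat ltn_ceil // expn_gt0.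
Qed.

Lemma scaled_dist n (a c : R) :
  `|a - c| * e.+1%:R ^+ n = `|a * e.+1%:R ^+ n - c * e.+1%:R ^+ n|.
Proof. by rewrite -mulrBl normrM (gtr0_norm (base_gt0 n)). Qed.

Lemma cube_dist n p x y i : cube n p x -> cube n p y ->
  `|x 0 i - y 0 i| * e.+1%:R ^+ n <= 1.
Proof. by move=> /(_ i) + /(_ i); rewrite scaled_dist ler_norml -natr1; lra. Qed.

Lemma cube_adj n p q x y : cube n p x -> cube n q y ->
  (forall i, `|x 0 i - y 0 i| * e.+1%:R ^+ n < 1) -> adj p q.
Proof.
move=> px qy xy; apply/forallP=> i; have := px i; have := qy i; have := xy i.
rewrite scaled_dist ltr_norml -!natr1 => h1 h2 h3.
by apply/andP; split; rewrite -ltnS -(ltr_nat R) -!natr1; move: h1 h2 h3; lra.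
Qed.

Lemma adj_cube_dist n p q x y i : cube n p x -> cube n q y -> adj p q ->
  `|x 0 i - y 0 i| * e.+1%:R ^+ n <= 2.
Proof.
move=> /(_ i) px /(_ i) qy /forallP/(_ i).
by rewrite scaled_dist ler_norml -2!(ler_nat R); move: px qy; rewrite -!natr1; lra.
Qed.

Lemma nested_point (l u : nat -> R) : (forall k, l k <= l k.+1) ->
  (forall k, u k.+1 <= u k) -> (forall k, l k <= u k) ->
  exists z, forall k, l k <= z <= u k.
Proof.
move=> lS uS lu.
have lm k j : l k <= l (k + j)%N by elim: j => [|j IH]; rewrite ?addn0 // addnS (le_trans IH).
have um k j : u (k + j)%N <= u k.
  by elim: j => [|j IH]; rewrite ?addn0 // addnS (le_trans _ IH).
have lu' j k : l j <= u k.
  by rewrite (le_trans (lm j k)) // (le_trans (lu _)) // addnC.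
exists (sup (range l)) => k; apply/andP; split.
  apply: sup_upper_bound; last by exists k.
  by split; [exists (l 0%N), 0%N|exists (u 0%N) => _ [j _ <-]].
by apply: ge_sup; [exists (l 0%N), 0%N|move=> _ [j _ <-]].
Qed.

Lemma branch_point (n m : nat -> nat) (q : nat -> cell d) :
  (forall k, n k.+1 = n k + m k)%N -> (forall k, ancestor e (m k) (q k.+1) = q k) ->
  exists x, forall k, cube (n k) (q k) x.
Proof.
move=> nS qS.
have scaleK (a c : R) k : a / (e.+1%:R ^+ n k * c) * e.+1%:R ^+ n k = a / c.
  by rewrite invfM [_^-1 * _]mulrC mulrA mulfVK // gt_eqF ?base_gt0.
have H i : exists xi : R, forall k, (q k i)%:R / e.+1%:R ^+ n k <= xi <= (q k i).+1%:R / e.+1%:R ^+ n k.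
  apply: nested_point => k.
  - rewrite nS exprD -(qS k) ffunE ler_pdivrMr ?base_gt0 // scaleK.
    by rewrite ler_pdivlMr ?base_gt0 // -natrX -natrM ler_nat leq_trunc_div.
  - rewrite nS exprD -(qS k) ffunE ler_pdivlMr ?base_gt0 // scaleK.
    rewrite ler_pdivrMr ?base_gt0 // -natrX -natrM ler_nat.
    by rewrite ltn_ceil // expn_gt0.
  - by rewrite ler_pM2r ?invr_gt0 ?base_gt0 // ler_nat.
have [f fP] := choice H.
exists (\row_i f i) => k i; rewrite mxE; have := fP i k.
by rewrite ler_pdivrMr ?base_gt0 // ler_pdivlMr ?base_gt0.
Qed.

End Cubes.

Section LimitSet.
Variables (R : realType) (d e : nat) (S : ladder d e).
Implicit Types (p q u v : cell d) (x y : 'rV[R]_d.+2).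

Definition limit_set : set 'rV[R]_d.+2 :=
  [set x | forall n, exists2 p, p \in cells S n & cube e n p x].

(** Koenig's lemma. The branch of bad cells shrinks to a point of the limit set. *)
Lemma koenig (bad : nat -> cell d -> Prop) n p : p \in cells S n -> bad n p ->
  (forall m q, q \in cells S m -> bad m q ->
     exists q', [/\ q' \in cells S m.+1, parent e q' = q & bad m.+1 q']) ->
  exists x, [/\ limit_set x, cube e n p x &
    forall k, exists q, [/\ q \in cells S (n + k), bad (n + k)%N q & cube e (n + k) q x]].
Proof.
move=> pn bp step.
pose good k q := q \in cells S (n + k) /\ bad (n + k)%N q.
have next k (q : {q | good k q}) :
    {q' : {q' | good k.+1 q'} | parent e (sval q') = sval q}.
  apply: cid; case: q => q /= [qn bq].
  have [q' []] := step _ _ qn bq; rewrite -addnS => q'n qq' bq'.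
  by exists (exist _ q' (conj q'n bq')).
have g0 : good 0%N p by rewrite /good addn0.
pose Q := nat_rect (fun k => {q | good k q}) (exist (good 0%N) p g0) (fun k z => sval (next k z)).
have QS k : ancestor e 1 (sval (Q k.+1)) = sval (Q k).
  by rewrite ancestor1; exact: (svalP (next k (Q k))).
have [|x xQ] := @branch_point R d e (fun k => n + k)%N (fun=> 1%N) (fun k => sval (Q k)) _ QS.
  by move=> k; rewrite addn1 addnS.
exists x; split.
- move=> m; have [Qn _] := svalP (Q m).
  exists (ancestor e n (sval (Q m))); first by apply: cells_ancestor; rewrite addnC.
  by apply: cube_ancestor; rewrite addnC.
- by have := xQ 0%N; rewrite addn0.
- by move=> k; exists (sval (Q k)); have [] := svalP (Q k).
Qed.

Lemma child_exists n p : p \in cells S n ->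
  exists2 q, q \in cells S n.+1 & parent e q = p.
Proof.
move=> pn; have /card_gt0P[a aP] : (0 < #|pattern S n p|)%N.
  by rewrite card_pattern muln_gt0 ladder_mult.
by exists (child p a); rewrite ?mem_cells ?parent_child ?digit_child ?pn.
Qed.

Lemma cell_point n p : p \in cells S n -> exists2 x, limit_set x & cube e n p x.
Proof.
move=> pn; have [||x [xE px _]] := @koenig (fun _ _ => True) n p pn => //.
  by move=> m q qm _; have [q' q'm qq'] := child_exists qm; exists q'.
by exists x.
Qed.

Lemma limit_set_unit x i : limit_set x -> 0 <= x 0 i <= 1.
Proof.
by move=> /(_ 0%N)[p]; rewrite inE => /eqP-> /(_ i); rewrite ffunE expr0 mulr1.
Qed.

Lemma base_grows (y : R) : 0 < y -> exists n, 1 <= y * e.+1%:R ^+ n.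
Proof.
move=> y0; have e1 := ladder_base S.
have [k _ ky] : exists2 k, True & y^-1 <= k%:R.
  by exists (Num.bound y^-1) => //; rewrite ltW // archi_boundP // invr_ge0 ltW.
exists k; rewrite mulrC -ler_pdivrMr // mul1r (le_trans ky) // -natrX ler_nat ltnW //.
by rewrite ltn_expl // ltnS ltnW.
Qed.

End LimitSet.

(** * Euclidean norm, real powers and diameters *)

Section Norms.
Variables (R : realType).

Lemma enorm_coord n (x : 'rV[R]_n) i : `|x 0 i| <= enorm x.
Proof.
rewrite -sqrtr_sqr ler_wsqrtr // (bigD1 i) //= lerDl sumr_ge0 // => j _; exact: sqr_ge0.
Qed.

Lemma enorm_ge0 n (x : 'rV[R]_n) : 0 <= enorm x.
Proof. exact: sqrtr_ge0. Qed.

Lemma enorm_le n (x : 'rV[R]_n) M : 0 <= M -> (forall i, `|x 0 i| <= M) ->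
  enorm x <= n%:R * M.
Proof.
move=> M0 xM; have nM0 : 0 <= n%:R * M by rewrite mulr_ge0.
rewrite -[leRHS]ger0_norm // -sqrtr_sqr ler_wsqrtr //.
apply: (@le_trans _ _ (\sum_(i < n) M ^+ 2)).
  by apply: ler_sum => i _; rewrite -real_normK ?num_real // lerXn2r ?nnegrE.
rewrite sumr_const card_ord -[leLHS]mulr_natl exprMn ler_wpM2r ?sqr_ge0 //.
by rewrite -natrX ler_nat; case: n {x xM nM0} => // n; rewrite expnS expn1 leq_pmull.
Qed.

Lemma powR_le (a c r : R) : 0 <= a -> 0 <= r -> a <= c -> a `^ r <= c `^ r.
Proof.
by move=> a0 r0 ac; apply: ge0_ler_powR; rewrite ?nnegrE // (le_trans a0).
Qed.

Lemma powR1r (r : R) : 1 `^ r = 1.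
Proof. by rewrite powR1. Qed.

Lemma powRMV (a c r : R) : 0 <= a -> 0 <= c -> (a / c) `^ r = a `^ r / c `^ r.
Proof. by move=> a0 c0; rewrite powRM ?invr_ge0 // -powR_inv1 // powRAC powR_inv1 ?powR_ge0. Qed.

Lemma ediam_le n (A : set 'rV[R]_n) (D : R) : 0 <= D ->
  (forall x y, A x -> A y -> enorm (x - y) <= D) -> (ediam A <= D%:E)%E.
Proof.
move=> D0 AD; apply: ge_ereal_sup => _ [->|[x [y [Ax Ay ->]]]]; rewrite lee_fin //.
exact: AD.
Qed.

Lemma ediam_ge n (A : set 'rV[R]_n) x y : A x -> A y -> ((enorm (x - y))%:E <= ediam A)%E.
Proof. by move=> Ax Ay; apply: ereal_sup_ubound; right; exists x, y. Qed.

Lemma ediam_ge0 n (A : set 'rV[R]_n) : (0 <= ediam A)%E.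
Proof. by apply: ereal_sup_ubound; left. Qed.

Lemma ediam0 n : ediam (set0 : set 'rV[R]_n) = 0%E.
Proof.
apply/eqP; rewrite eq_le ediam_ge0 andbT; apply: ediam_le => //.
Qed.

End Norms.

(** * Ahlfors regularity *)

Section Regularity.
Variables (R : realType) (d e : nat) (S : ladder d e) (s : R).
Hypothesis s1 : 1 < s.
Hypothesis size_S : forall n,
  2^-1 * (e.+1%:R ^+ n) `^ s <= (size (cells S n))%:R <= 2 * (e.+1%:R ^+ n) `^ s.
Implicit Types (p q u v : cell d) (x y : 'rV[R]_d.+2).
Local Notation B n := (e.+1%:R ^+ n : R).
Local Notation E := (@limit_set R d e S).

Lemma s_ge0 : 0 <= s.
Proof. by rewrite ltW // (lt_trans _ s1). Qed.

Definition hit (U : set 'rV[R]_d.+2) n p : bool := `[< exists2 x, U x & cube e n p x >].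

Definition hit_const : R := 3 ^+ d.+2 * 4 * e.+1%:R `^ s.

Lemma powB_gt0 n : 0 < B n `^ s.
Proof. exact: powR_gt0 (base_gt0 _ _ _). Qed.

Lemma count_near_le n k u :
  (count (fun p => adj u (ancestor e k p)) (cells S (n + k)))%:R * B n `^ s
    <= 3 ^+ d.+2 * 4 * B (n + k) `^ s.
Proof.
have := count_near S n k u; set c := count _ _; rewrite -(ler_nat R) (natrM _ c) (natrM _ (3 ^ _)) natrX => H.
have /andP[lo _] := size_S n; have /andP[_ hi] := size_S (n + k).
have c0 : 0 <= c%:R :> R by [].
have t0 : 0 <= 3 ^+ d.+2 :> R by rewrite exprn_ge0.
have := ler_wpM2l c0 lo; have := ler_wpM2l t0 hi; lra.
Qed.

Lemma hit_const_ge1 : 1 <= hit_const.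
Proof.
have t1 : 1 <= 3 ^+ d.+2 :> R by rewrite exprn_ege1 // ler1n.
have b1 : 1 <= e.+1%:R `^ s by rewrite -[leLHS](powRr0 e.+1%:R) ler_powR ?s_ge0 // ler1n.
by rewrite /hit_const -[leLHS]mulr1 ler_pM // -[leLHS]mulr1 ler_pM // ler1n.
Qed.

(** At the last level where the cells are larger than [D], the cells met by [U] touch
    each other, so that there are at most [3 ^ d.+2] of them; their descendants are
    counted with [size_S]. *)
Lemma hit_count (U : set 'rV[R]_d.+2) D n : 0 < D ->
  (forall x y i, U x -> U y -> `|x 0 i - y 0 i| <= D) -> 1 <= D * B n ->
  (count (hit U n) (cells S n))%:R <= hit_const * (D * B n) `^ s.
Proof.
move=> D0 UD Dn.
have exn : exists n, 1 <= D * B n by exists n.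
have DB0 k : 0 <= D * B k by rewrite mulr_ge0 ?ltW // base_gt0.
case: (ex_minnP exn) => -[|n1] Dn1 min1.
  rewrite expr0 mulr1 in Dn1.
  apply: (@le_trans _ _ (size (cells S n))%:R); first by rewrite ler_nat count_size.
  have /andP[_ hi] := size_S n; apply: le_trans hi _.
  rewrite powRM ?(ltW D0) ?exprn_ge0 // mulrA ler_wpM2r ?powR_ge0 //.
  have : 1 <= D `^ s by rewrite -[leLHS](powRr0 D) ler_powR ?s_ge0.
  have t1 : 1 <= 3 ^+ d.+2 :> R by rewrite exprn_ege1 // ler1n.
  have b1 : 1 <= e.+1%:R `^ s by rewrite -[leLHS](powRr0 e.+1%:R) ler_powR ?s_ge0 // ler1n.
  rewrite /hit_const => D1.
  have tb : 1 <= 3 ^+ d.+2 * e.+1%:R `^ s by rewrite -[leLHS]mulr1 ler_pM.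
  have := ler_pM ler01 ler01 tb D1; lra.
have small : D * B n1 < 1.
  by rewrite ltNge; apply/negP => /min1; rewrite ltnn.
have n1n : (n1 <= n)%N by rewrite ltnW // (min1 n).
case: (boolP (has (hit U n) (cells S n))) => [/hasP[q qn /asboolP[x Ux qx]]|]; last first.
  rewrite has_count -leqNgt leqn0 => /eqP->; rewrite mulr_ge0 ?powR_ge0 //.
  by rewrite (le_trans ler01 hit_const_ge1).
pose k := (n - n1)%N; have nE : n = (n1 + k)%N by rewrite subnKC.
have sub : (count (hit U n) (cells S n) <=
    count (fun p => adj (ancestor e k q) (ancestor e k p)) (cells S n))%N.
  apply: sub_count => p /asboolP[y Uy py].
  apply: (@cube_adj R d e n1 _ _ x y) => [||i].
  - by apply: cube_ancestor; rewrite -nE.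
  - by apply: cube_ancestor; rewrite -nE.
  - by apply: le_lt_trans small; rewrite ler_wpM2r ?UD // ltW // base_gt0.
rewrite -(ler_nat R) in sub; apply: le_trans sub _.
have := count_near_le n1 k (ancestor e k q); rewrite -nE => H.
rewrite -(ler_pM2r (powB_gt0 n1)); apply: le_trans H _.
rewrite powRM ?(ltW D0) ?exprn_ge0 // /hit_const.
rewrite [leRHS](_ : _ = 3 ^+ d.+2 * 4 * B n `^ s * (e.+1%:R `^ s * (D `^ s * B n1 `^ s))); last by ring.
have t0 : 0 <= 3 ^+ d.+2 * 4 * B n `^ s by rewrite mulr_ge0 ?powR_ge0 // mulr_ge0 // exprn_ge0.
rewrite ler_peMr //.
rewrite -!powRM ?mulr_ge0 ?exprn_ge0 ?(ltW D0) //.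
rewrite -[leLHS](powR1r s); apply: powR_le; rewrite ?s_ge0 //.
by rewrite mulrCA -exprS.
Qed.


Lemma hit_bound : exists2 C, 1 <= C & forall (U : set 'rV[R]_d.+2) D n, 0 < D ->
  (forall x y i, U x -> U y -> `|x 0 i - y 0 i| <= D) -> 1 <= D * B n ->
  (count (hit U n) (cells S n))%:R <= C * (D * B n) `^ s.
Proof. by exists hit_const; [exact: hit_const_ge1|exact: hit_count]. Qed.

Variable C : R.
Hypothesis C_ge1 : 1 <= C.
Hypothesis hitC : forall (U : set 'rV[R]_d.+2) D n, 0 < D ->
  (forall x y i, U x -> U y -> `|x 0 i - y 0 i| <= D) -> 1 <= D * B n ->
  (count (hit U n) (cells S n))%:R <= C * (D * B n) `^ s.

Lemma finite_series_le (u : nat -> \bar R) K M :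
  (forall k, 0 <= u k)%E -> (forall k, (K <= k)%N -> u k = 0%E) ->
  (\sum_(0 <= k < K) u k <= M)%E -> (\sum_(0 <= k <oo) u k <= M)%E.
Proof.
move=> u0 uK uM; apply: lime_le; first by apply: is_cvg_nneseries => *; exact: u0.
near=> n; rewrite (@big_cat_nat _ _ _ K) //=; last by near: n; exists K.
have -> : (\sum_(K <= k < n) u k = 0)%E.
  by rewrite big_nat_cond big1 // => k /andP[/andP[Kk _] _]; exact: uK.
by rewrite adde0.
Unshelve. all: end_near. Qed.

(** Cover the ball by the cells of a fine level that meet it. *)
Lemma hausdorff_limit_le x r : 0 < r ->
  (hausdorff_measure s (E `&` eball x r)
    <= (C * (2 * d.+2%:R) `^ s * r `^ s)%:E)%E.
Proof.
move=> r0; apply: ge_ereal_sup => _ [delta /= delta0 <-].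
have [n1 Hn1] := base_grows S (mulr_gt0 (ltr0n R 2) r0).
have [n2 Hn2] := base_grows S (divr_gt0 delta0 (ltr0n R d.+2)).
pose n := maxn n1 n2.
have Bm j k : (j <= k)%N -> B j <= B k by move=> jk; rewrite ler_weXn2l // ler1n.
have Dn : 1 <= 2 * r * B n.
  by apply: le_trans Hn1 _; rewrite ler_wpM2l ?mulr_ge0 ?(ltW r0) // Bm // leq_maxl.
have dn : d.+2%:R / B n <= delta.
  have B0 := base_gt0 R e n; rewrite ler_pdivrMr //.
  have Hn : 1 <= delta / d.+2%:R * B n.
    by apply: le_trans Hn2 _; rewrite ler_wpM2l ?divr_ge0 ?(ltW delta0) // Bm // leq_maxr.
  by rewrite mulrAC ler_pdivlMr // mul1r in Hn.
pose U := E `&` eball x r.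
pose l := [seq p <- cells S n | hit U n p].
pose V k : set 'rV[R]_d.+2 := if (k < size l)%N then cube e n (nth [ffun => 0%N] l k) else set0.
have V_diam k : (ediam (V k) <= (d.+2%:R / B n)%:E)%E.
  have D0 : 0 <= d.+2%:R / B n by rewrite divr_ge0 // ltW // base_gt0.
  apply: ediam_le => // y z; rewrite /V; case: ifP => // _ yc zc.
  apply: enorm_le => [|i]; first by rewrite invr_ge0 ltW // base_gt0.
  by rewrite !mxE -[leRHS]mul1r ler_pdivlMr ?base_gt0 // (cube_dist _ yc).
apply: (@le_trans _ _ (\sum_(0 <= k <oo) ediam (V k) `^ s)%E).
  apply: ereal_inf_lbound; exists V; split=> //.
    move=> y Uy; have [p pn py] := Uy.1 n.
    have pl : p \in l by rewrite mem_filter pn andbT; apply/asboolP; exists y.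
    by exists (index p l) => //=; rewrite /V index_mem pl nth_index.
  by move=> k; apply: le_trans (V_diam k) _; rewrite lee_fin.
apply: (@finite_series_le _ (size l)) => [k|k lk|].
- exact: poweR_ge0.
- by rewrite /V ltnNge lk /= ediam0 poweR0r // gt_eqF // (lt_trans _ s1).
apply: (@le_trans _ _ (\sum_(0 <= k < size l) ((d.+2%:R / B n) `^ s)%:E)%E).
  apply: lee_sum => k _; rewrite -poweR_EFin; apply: gt0_ler_poweR.
  - exact: s_ge0.
  - by rewrite in_itv /= ediam_ge0 leey.
  - by rewrite in_itv /= lee_fin leey andbT divr_ge0 // ltW // base_gt0.
  - exact: V_diam.
rewrite sumEFin lee_fin sumr_const_nat subn0 -[leLHS]mulr_natl.
have UD y z i : U y -> U z -> `|y 0 i - z 0 i| <= 2 * r.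
  move=> [_ Uy] [_ Uz]; have := le_trans (enorm_coord (y - x) i) Uy.
  have := le_trans (enorm_coord (z - x) i) Uz; rewrite !mxE !ler_norml; lra.
have := hitC (mulr_gt0 (ltr0n R 2) r0) UD Dn; rewrite -size_filter -/l => H.
have := ler_wpM2r (powR_ge0 (d.+2%:R / B n) s) H; move/le_trans; apply.
rewrite -[leLHS]mulrA -[leRHS]mulrA ler_wpM2l ?(le_trans ler01 C_ge1) //.
have B0 := base_gt0 R e n.
have D0 : 0 <= 2 * r by rewrite mulr_ge0 // ltW.
have N0 : 0 <= 2 * d.+2%:R :> R by rewrite mulr_ge0.
have DB0 : 0 <= 2 * r * B n by rewrite mulr_ge0 // ltW.
rewrite -powRM ?divr_ge0 ?(ltW B0) //.
rewrite -powRM ?(ltW r0) //; apply: powR_le; rewrite ?s_ge0 //.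
  by rewrite mulr_ge0 ?divr_ge0 ?(ltW B0).
by rewrite le_eqVlt; apply/orP; left; apply/eqP; field; rewrite gt_eqF.
exact: ltW.
Qed.

(** ** The mass distribution principle *)

Definition thicken (U : set 'rV[R]_d.+2) (eta : R) : set 'rV[R]_d.+2 :=
  [set y | exists2 z, U z & forall i, `|y 0 i - z 0 i| <= eta].

(** Compactness of the part of the limit set in a cell, in combinatorial form: if
    no level is covered by finitely many thickened sets, [koenig] provides a point
    of the limit set, and the thickening of any set containing that point contains
    a whole cell of the branch. *)
Lemma cover_cells (U : nat -> set 'rV[R]_d.+2) (eta : nat -> R) n p :
  p \in cells S n -> (forall k, 0 < eta k) -> E `&` cube e n p `<=` \bigcup_k U k ->
  exists K, forall q, q \in cells S (n + K) -> ancestor e K q = p ->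
    exists2 k, (k < K)%N & cube e (n + K) q `<=` thicken (U k) (eta k).
Proof.
move=> pn eta0 cov.
pose good m q K := forall q', q' \in cells S (m + K) -> ancestor e K q' = q ->
    exists2 k, (k < K)%N & cube e (m + K) q' `<=` thicken (U k) (eta k).
have good_mono m q K J : good m q K -> (K <= J)%N -> good m q J.
  move=> gK KJ q' q'n q'q; have JE : (J = K + (J - K))%N by rewrite subnKC.
  have [||k kK sub] := gK (ancestor e (J - K) q').
  - by apply: cells_ancestor; rewrite -addnA -JE.
  - by rewrite -ancestorD -JE.
  exists k; first exact: leq_trans kK KJ.
  move=> x xq'; apply: sub; apply: cube_ancestor; by rewrite -addnA -JE.
apply: contrapT => nogood.
have [|x [xE xp xbad]] := @koenig R d e S (fun m q => ~ exists K, good m q K) n p pn nogood.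
  move=> m q qm qbad; apply: contrapT => nobad; apply: qbad.
  have H c : c \in cells S m.+1 -> exists K, parent e c = q -> good m.+1 c K.
    move=> cm; apply: contrapT => noK; apply: nobad; exists c; split=> //.
      by apply: contrapT => cq; apply: noK; exists 0%N.
    by move=> [K gK]; apply: noK; exists K.
  have [K HK] : exists K, forall c, c \in cells S m.+1 -> parent e c = q -> good m.+1 c K.
    elim: (cells S m.+1) H => [|c l IH] H; first by exists 0%N.
    have [|K HK] := IH; first by move=> c' c'l; apply: H; rewrite inE c'l orbT.
    have [|J HJ] := H c; first by rewrite inE eqxx.
    exists (maxn K J) => c'; rewrite inE => /orP[/eqP-> /HJ g|/HK g /g {}g].
      by apply: good_mono g _; rewrite leq_maxr.
    by apply: good_mono g _; rewrite leq_maxl.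
  exists K.+1 => q' q'm q'q.
  have q'm' : q' \in cells S (m.+1 + K) by rewrite addSnnS.
  have par_q : parent e (ancestor e K q') = q by rewrite -ancestorSr.
  have [k kK sub] := HK _ (cells_ancestor q'm') par_q q' q'm' erefl.
  by exists k; [exact: ltnW|rewrite -addSnnS].
have [k _ Ux] := cov x (conj xE xp).
have [j Hj] := base_grows S (eta0 k).
have [q [qn qbad xq]] := xbad j; apply: qbad; exists k.+1 => q' q'n q'q.
exists k => // y yq'; exists x => // i.
have := cube_dist i (_ : cube e (n + j) q y) xq; rewrite -q'q => /(_ (cube_ancestor yq')) H.
rewrite -(ler_pM2r (base_gt0 R e (n + j))); apply: le_trans H _.
apply: le_trans Hj _; rewrite ler_wpM2l ?(ltW (eta0 _)) // ler_weXn2l ?ler1n //.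
exact: leq_addl.
Qed.

Lemma geometric_sum_le (eps : R) K : 0 <= eps ->
  \sum_(0 <= k < K) eps / 2 ^+ k.+1 <= eps.
Proof.
move=> eps0; suff -> : \sum_(0 <= k < K) eps / 2 ^+ k.+1 = eps - eps / 2 ^+ K.
  by rewrite gerBl divr_ge0 // exprn_ge0.
elim: K => [|K IH]; first by rewrite big_nil expr0 divr1 subrr.
rewrite big_nat_recr //= IH exprS; field; by rewrite expf_neq0.
Qed.

(** [C] bounds the cells hit by a set, [6 `^ s] pays for thickening the sets of a cover,
    and 8 is 4 (numbers of cells are known up to a factor 2 at two levels) times 2
    (half of the mass is lost to the thickening of sets of diameter close to 0). *)
Definition mass_const : R := (8 * C * 6 `^ s)^-1.

Lemma mass_const_gt0 : 0 < mass_const.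
Proof.
by rewrite invr_gt0 mulr_gt0 ?powR_gt0 // mulr_gt0 // (lt_le_trans ltr01 C_ge1).
Qed.

(** Mass distribution: all descendants of [p] at a fine level are hit by finitely many
    sets of the cover, slightly thickened, and each of these hits a number of cells
    controlled by the power [s] of its diameter. *)
Lemma cover_mass (U : nat -> set 'rV[R]_d.+2) (D : nat -> R) n p : p \in cells S n ->
  (forall k, 0 <= D k) ->
  (forall k x y i, U k x -> U k y -> `|x 0 i - y 0 i| <= D k) ->
  E `&` cube e n p `<=` \bigcup_k U k ->
  exists K, mass_const / B n `^ s <= \sum_(0 <= k < K) D k `^ s.
Proof.
move=> pn D0 UD cov.
have P0 := powB_gt0 n; have C0 : 0 < C by rewrite (lt_le_trans ltr01 C_ge1).
have M0 := mass_const_gt0.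
pose eps := mass_const / B n `^ s.
have eps0 : 0 < eps by rewrite divr_gt0.
have eps1 : eps <= 1.
  rewrite ler_pdivrMr // mul1r (@le_trans _ _ 1) //.
    have X8 : 0 < 8 * C * 6 `^ s by rewrite -invr_gt0.
    rewrite invf_le1 //.
    have : 1 <= 6 `^ s :> R by rewrite -[leLHS](powR1r s) powR_le ?s_ge0 // ler1n.
    move: C_ge1; move: (C) (6 `^ s) => a c a1 c1.
    have := ler_pM ler01 ler01 a1 c1; lra.
  by rewrite -[leLHS](powR1r s) powR_le ?s_ge0 // exprn_ege1 // ler1n.
pose ep k := eps / 2 ^+ k.+1.
have ep0 k : 0 < ep k by rewrite divr_gt0 // exprn_gt0.
have ep1 k : ep k <= 1.
  by rewrite ler_pdivrMr ?exprn_gt0 // mul1r (le_trans eps1) // exprn_ege1 // ler1n.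
(* Thickening by the diameter costs a constant factor; [ep] handles diameter 0. *)
pose eta k := D k + ep k.
have eta0 k : 0 < eta k by rewrite ltr_wpDl.
have [K HK] := cover_cells pn eta0 cov.
pose D' k := D k + 2 * eta k.
have D'0 k : 0 < D' k by rewrite ltr_wpDl // mulr_gt0.
have [m Hm] : exists m, forall k, (k < K)%N -> 1 <= D' k * B (n + K + m).
  elim: {-2}K => [|L [m Hm]]; first by exists 0%N.
  have [j Hj] := base_grows S (D'0 L); exists (maxn m j) => k; rewrite ltnS leq_eqVlt.
  move=> /orP[/eqP->|/Hm H].
    apply: le_trans Hj _; rewrite ler_wpM2l ?(ltW (D'0 _)) // ler_weXn2l ?ler1n //.
    by rewrite (leq_trans (leq_maxr m j)) // leq_addl.
  apply: le_trans H _; rewrite ler_wpM2l ?(ltW (D'0 _)) // ler_weXn2l ?ler1n //.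
  by rewrite leq_add2l leq_maxl.
exists K.
pose N := (n + K + m)%N.
have cardH : (count (fun q => ancestor e (K + m) q == p) (cells S N) <=
    \sum_(0 <= k < K) count (hit (thicken (U k) (eta k)) N) (cells S N))%N.
  rewrite -sum1_count big_mkcond /=.
  under [leqRHS]eq_bigr do rewrite -sum1_count big_mkcond.
  rewrite exchange_big /= big_seq [leqRHS]big_seq; apply: leq_sum => q qN.
  case: eqP => // qp.
  have [||k kK sub] := HK (ancestor e m q); first exact: cells_ancestor.
    by rewrite -ancestorD.
  rewrite big_mkord (bigD1 (Ordinal kK)) //= ifT ?leq_addr //.
  have [x _ xq] := cell_point R qN; apply/asboolP; exists x => //.
  exact/sub/cube_ancestor.
have lower : 4^-1 * (B N `^ s / B n `^ s) <=
    (count (fun q => ancestor e (K + m) q == p) (cells S N))%:R.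
  have := count_descendants S n (K + m) p; rewrite addnA pn muln1 -/N => /(congr1 (fun z : nat => z%:R : R)).
  rewrite natrM; have /andP[lo _] := size_S N; have /andP[_ hi] := size_S n.
  set c := (count _ _)%:R => cE.
  rewrite mulrA ler_pdivrMr //.
  have c0 : 0 <= c by rewrite /c.
  have := ler_wpM2l c0 hi; rewrite cE; lra.
have upper k : (k < K)%N -> (count (hit (thicken (U k) (eta k)) N) (cells S N))%:R <=
    C * (D' k * B N) `^ s.
  move=> kK; apply: hitC => // [x y i [x' x'U xx'] [y' y'U yy']|]; last exact: Hm.
  have := UD k _ _ i x'U y'U; have := xx' i; have := yy' i.
  rewrite /D' !ler_norml; lra.
rewrite -(ler_nat R) in cardH; have {}cardH := le_trans lower cardH.
(* [D' <= 3 D + 2 ep <= 6 max(D, ep)], and [ep <= 1] gives [ep `^ s <= ep]. *)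
have split_pow k : D' k `^ s <= 6 `^ s * (D k `^ s + ep k).
  apply: (@le_trans _ _ ((6 * Num.max (D k) (ep k)) `^ s)).
    apply: powR_le; rewrite ?s_ge0 ?(ltW (D'0 _)) // /D' /eta.
    have : D k <= Num.max (D k) (ep k) by rewrite le_max lexx.
    have : ep k <= Num.max (D k) (ep k) by rewrite le_max lexx orbT.
    have := D0 k; lra.
  rewrite powRM ?ler0n ?le_max ?D0 // ler_wpM2l ?powR_ge0 //.
  have e1 : ep k `^ s <= ep k by rewrite ge1r_powR ?ep0 ?ep1 ?(ltW s1).
  have := powR_ge0 (D k) s; have := ltW (ep0 k).
  by case: (leP (D k) (ep k)) => _; lra.
have total : (\sum_(0 <= k < K) count (hit (thicken (U k) (eta k)) N) (cells S N))%:R <=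
    C * 6 `^ s * B N `^ s * (\sum_(0 <= k < K) D k `^ s + eps).
  rewrite natr_sum.
  apply: (@le_trans _ _ (\sum_(0 <= k < K) C * 6 `^ s * B N `^ s * (D k `^ s + ep k))).
    rewrite !big_nat; apply: ler_sum => k /andP[_ kK]; apply: le_trans (upper k kK) _.
    rewrite powRM ?(ltW (D'0 _)) ?exprn_ge0 // -!mulrA ler_wpM2l ?(ltW C0) //.
    rewrite [leLHS]mulrC [leRHS]mulrCA ler_wpM2l ?powR_ge0 //; exact: split_pow.
  rewrite -big_distrr /= big_split /= ler_wpM2l ?mulr_ge0 ?powR_ge0 ?(ltW C0) //.
  by rewrite lerD2l; apply/geometric_sum_le/ltW.
have {total}cardH := le_trans cardH total.
have BN := powB_gt0 N.
have {}cardH : 4^-1 / B n `^ s <= C * 6 `^ s * (\sum_(0 <= k < K) D k `^ s + eps).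
  rewrite -(ler_pM2r BN); apply: le_trans (le_trans cardH _); rewrite le_eqVlt; apply/orP; left; apply/eqP; ring.
have X0 : 0 < C * 6 `^ s by rewrite mulr_gt0 ?powR_gt0.
have epsE : C * 6 `^ s * eps = 8^-1 / B n `^ s.
  rewrite /eps /mass_const; field; by rewrite !gt_eqF ?powR_gt0.
rewrite -(ler_pM2l X0) -/eps epsE; move: cardH; rewrite mulrDr epsE; move: (_ * \sum_(_ <= _ < _) _) => Z.
have : 4^-1 / B n `^ s = 8^-1 / B n `^ s + 8^-1 / B n `^ s by field; rewrite gt_eqF.
lra.
Qed.

(** The ball contains a cell around [x] of comparable size, to which [cover_mass] applies. *)
Lemma hausdorff_limit_ge x r : E x -> 0 < r -> r <= d.+2%:R ->
  ((mass_const / (d.+2%:R * e.+1%:R) `^ s * r `^ s)%:E <=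
    hausdorff_measure s (E `&` eball x r))%E.
Proof.
move=> Ex r0 rN; have Npos : 0 < d.+2%:R :> R by [].
have [n [Hn Hn']] : exists n, d.+2%:R <= r * B n /\ r * B n <= d.+2%:R * e.+1%:R.
  have exn : exists n, d.+2%:R <= r * B n.
    have [n Hn] := base_grows S (divr_gt0 r0 Npos).
    by exists n; rewrite mulrAC ler_pdivlMr // mul1r in Hn.
  case: (ex_minnP exn) => -[|n] Hn nmin.
    by exists 0%N; split=> //; rewrite expr0 mulr1 (le_trans rN) // ler_peMr // ler1n.
  exists n.+1; split=> //; rewrite exprSr mulrA ler_wpM2r // leNgt; apply/negP => /ltW /nmin.
  by rewrite ltnn.
have Bn := base_gt0 R e n.
have [p pn px] := Ex n.
have cube_ball : E `&` cube e n p `<=` E `&` eball x r.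
  move=> y [Ey py]; split=> //; rewrite /eball /=.
  apply: (@le_trans _ _ (d.+2%:R * (B n)^-1)); last by rewrite ler_pdivrMr.
  apply: enorm_le => [|i]; first by rewrite invr_ge0 ltW.
  by rewrite !mxE -[leRHS]mul1r ler_pdivlMr // (cube_dist _ py).
apply: (@le_trans _ _ (hausdorff_delta s 1 (E `&` eball x r))); last first.
  by apply: ereal_sup_ubound; exists 1 => //=; exact: ltr01.
apply: le_ereal_inf_tmp => _ [U [cov diam ->]].
pose D k := fine (ediam (U k)).
have DE k : ediam (U k) = (D k)%:E.
  rewrite fineK // ge0_fin_numE ?ediam_ge0 //.
  by rewrite (le_lt_trans (diam k)) // ltry.
have D0 k : 0 <= D k by rewrite -lee_fin -DE ediam_ge0.
have UD k y z i : U k y -> U k z -> `|y 0 i - z 0 i| <= D k.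
  move=> yU zU; have := enorm_coord (y - z) i; rewrite !mxE => /le_trans; apply.
  by rewrite -lee_fin -DE; apply: ediam_ge.
have [K HK] := cover_mass pn D0 UD (subset_trans cube_ball cov).
apply: (@le_trans _ _ (\sum_(0 <= k < K) ediam (U k) `^ s)%E); last first.
  by apply: nneseries_lim_ge => k _ _; apply: poweR_ge0.
under eq_bigr do rewrite DE poweR_EFin.
rewrite sumEFin lee_fin; apply: le_trans HK.
have M0 := mass_const_gt0; have P0 := powB_gt0 n.
rewrite -mulrA ler_wpM2l ?(ltW M0) // mulrC ler_pdivrMr; last by rewrite powR_gt0 // mulr_gt0.
rewrite mulrC ler_pdivlMr // -powRM ?(ltW r0) ?(ltW Bn) //.
by apply: powR_le; rewrite ?s_ge0 // mulr_ge0 ?(ltW r0) ?(ltW Bn).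
Qed.

Lemma ediam_limit : (ediam E <= (d.+2%:R)%:E)%E.
Proof.
apply: ediam_le => // x y Ex Ey; rewrite -[leRHS]mulr1; apply: enorm_le => // i.
have := limit_set_unit i Ex; have := limit_set_unit i Ey; rewrite !mxE ler_norml; lra.
Qed.

Lemma limit_ahlfors : ahlfors_regular s E.
Proof.
pose c := mass_const / (d.+2%:R * e.+1%:R) `^ s.
have c0 : 0 < c by rewrite divr_gt0 ?mass_const_gt0 // powR_gt0 // mulr_gt0.
pose C' := C * (2 * d.+2%:R) `^ s.
have C'0 : 0 <= C' by rewrite mulr_ge0 ?powR_ge0 // (le_trans ler01).
exists c, (c + C'); split=> // [|x r Ex r0 rdiam]; first by rewrite lerDl.
split.
  by apply: hausdorff_limit_ge => //; rewrite -lee_fin (le_trans rdiam) // ediam_limit.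
apply: le_trans (hausdorff_limit_le x r0) _; rewrite lee_fin -/C'.
by rewrite ler_wpM2r ?powR_ge0 // lerDr ltW.
Qed.

End Regularity.

Lemma ladder_ahlfors (R : realType) d e (S : ladder d e) (s : R) : 1 < s ->
  (forall n, 2^-1 * (e.+1%:R ^+ n) `^ s <= (size (cells S n))%:R
               <= 2 * (e.+1%:R ^+ n) `^ s) ->
  ahlfors_regular s (@limit_set R d e S).
Proof.
move=> s1 Hs; have [C C1 HC] := hit_bound s1 Hs.
exact: (limit_ahlfors s1 Hs C1 HC).
Qed.

(** * The limit set is a curve *)

Section Steps.
Variable R : realType.

(** The number of the interval of length [n^-1] that contains [t], the last one being
    extended to the right so as to include [t = 1]. *)
Definition slot (n : nat) (t : R) : nat := minn (Num.truncn (t * n%:R)) n.-1.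

Lemma slot_lt n t : (0 < n)%N -> (slot n t < n)%N.
Proof. by move=> n0; rewrite /slot -[ltnRHS](prednK n0) ltnS geq_minr. Qed.

Lemma truncn_div (y : R) L : (0 < L)%N -> (Num.truncn (y * L%:R) %/ L)%N = Num.truncn y.
Proof.
move=> L0; have LR : 0 < L%:R :> R by rewrite ltr0n.
case: (lerP 0 y) => [y0|yneg]; last first.
  have -> : Num.truncn y = 0%N by apply/truncn0Pn; rewrite -ltNge (lt_trans yneg).
  suff -> : Num.truncn (y * L%:R) = 0%N by rewrite div0n.
  by apply/truncn0Pn; rewrite -ltNge (lt_trans _ ltr01) // nmulr_rlt0.
have /andP[lo hi] := truncn_itv y0.
have yL0 : 0 <= y * L%:R by rewrite mulr_ge0 // ltW.
have Hlo : (Num.truncn y * L <= Num.truncn (y * L%:R))%N.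
  by rewrite truncn_ge_nat // natrM ler_wpM2r // ltW.
have Hhi : (Num.truncn (y * L%:R) < (Num.truncn y).+1 * L)%N.
  by rewrite truncn_lt_nat // natrM ltr_pM2r.
apply/eqP; rewrite eqn_leq; apply/andP; split; last by rewrite leq_divRL.
by rewrite -ltnS ltn_divLR.
Qed.

Lemma slot_div n L t : (0 < n)%N -> (0 < L)%N -> (slot (L * n) t %/ L)%N = slot n t.
Proof.
move=> n0 L0; rewrite /slot mulnC natrM mulrA.
have pE : ((n * L).-1 %/ L = n.-1)%N.
  rewrite -{1}(prednK n0) mulSn -subn1 addnC -addnBA // divnMDl // divn_small ?addn0 //.
  by rewrite subn1 prednK.
have tE := truncn_div (t * n%:R) L0.
set a := Num.truncn (t * n%:R * L%:R) in tE *; rewrite -tE -pE.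
rewrite /minn; case: ltnP => H; case: ltnP => // H'.
  by apply/eqP; rewrite eqn_leq H' leq_div2r // ltnW.
by apply/eqP; rewrite eqn_leq leq_div2r // ltnW.
Qed.

Lemma slot_near n t t' : (0 < n)%N -> `|t - t'| * n%:R < 1 ->
  (slot n t <= (slot n t').+1)%N.
Proof.
move=> n0 H; have tn : t * n%:R < t' * n%:R + 1.
  by rewrite -ltrBlDl -mulrBl (le_lt_trans _ H) // ler_wpM2r // ler_norm.
have trunc_near : (Num.truncn (t * n%:R) <= (Num.truncn (t' * n%:R)).+1)%N.
  rewrite truncn_le_nat (lt_trans tn) // -natr1 ltrD2r; exact: truncnS_gt.
by move: trunc_near; rewrite /slot; move: (Num.truncn _) (Num.truncn _) => a c; lia.
Qed.

Lemma slot_frac n k : (k < n)%N -> slot n (k%:R / n%:R) = k.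
Proof.
move=> kn; have n0 : (0 < n)%N by apply: leq_ltn_trans kn.
rewrite /slot mulfVK ?pnatr_eq0 -?lt0n // natrK; apply/minn_idPl; lia.
Qed.

End Steps.

Section Curve.
Variables (R : realType) (d e : nat) (S : ladder d e).
Variables (T k : nat -> nat).
Hypotheses (T0 : T 0 = 0%N) (TS : forall i, (T i.+1 = T i + (k i).+1)%N).
Hypothesis mT : forall i, milestone S (T i).
Hypothesis nmT : forall i j, (0 < j < (k i).+1)%N -> ~~ milestone S (T i + j)%N.
Local Notation E := (@limit_set R d e S).
Local Notation B n := (e.+1%:R ^+ n : R).
Local Notation none := ([ffun => 0%N] : cell d).

Lemma T_ge i : (i <= T i)%N.
Proof. by elim: i => // i IH; rewrite TS addnS ltnS (leq_trans IH) // leq_addr. Qed.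

(** At time [t] the walk of stage [i] is in its cell number [slot (n i) t]; these cells
    are nested and shrink to [g t]. Nearby times give touching cells, whence the
    modulus of continuity. *)
Lemma walk_parametrization : exists (n : nat -> nat) (g : R -> 'rV[R]_d.+2),
  [/\ forall i, (0 < n i)%N, forall t, E (g t),
      forall i t t' c, `|t - t'| * (n i)%:R < 1 -> `|g t 0 c - g t' 0 c| * B (T i) <= 2 &
      forall i x, E x -> exists2 t, 0 <= t <= 1 &
        forall c, `|g t 0 c - x 0 c| * B (T i) <= 1].
Proof.
have [w [L HwL]] := nested_walks T0 TS mT nmT.
pose n i := size (w i).
have n0 i : (0 < n i)%N by have [[+ _ _ _] _ _] := HwL i; rewrite /n; case: (w i).
pose q i (t : R) := nth none (w i) (slot (n i) t).
have qT i t : q i t \in cells S (T i).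
  have [[_ _ /allP wT _] _ _] := HwL i; apply: wT; apply: mem_nth; exact: slot_lt.
have q_anc i t : ancestor e (k i).+1 (q i.+1 t) = q i t.
  have [_ L0 [sz anc]] := HwL i.
  rewrite /q anc; last exact: slot_lt.
  by rewrite {1}/n sz -/(n i) slot_div.
have pt (t : R) : exists x : 'rV[R]_d.+2, forall i, cube e (T i) (q i t) x.
  exact: (branch_point R (m := fun i => (k i).+1) TS (fun i => q_anc i t)).
have [g gP] := choice pt.
exists n, g; split=> //.
- move=> t i; exists (ancestor e (T i - i) (q i t)).
    by apply: cells_ancestor; rewrite subnKC ?T_ge.
  by apply: cube_ancestor; rewrite subnKC ?T_ge.
- move=> i t t' c tt'; apply: (adj_cube_dist c (gP t i) (gP t' i)).
  have [[_ /(sortedP none) wadj _ _] _ _] := HwL i.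
  have := slot_near (n0 i) tt'; rewrite distrC in tt'; have := slot_near (n0 i) tt'.
  have := slot_lt t (n0 i); have := slot_lt t' (n0 i); rewrite /q.
  set a := slot _ t; set a' := slot _ t' => a'n an aa' a'a.
  case: (ltngtP a a') => [lt|lt|->]; last exact: adj_refl.
    by have -> : a' = a.+1 by [lia]; apply: wadj; rewrite -/(n i); lia.
  by have -> : a = a'.+1 by [lia]; rewrite adj_sym; apply: wadj; rewrite -/(n i); lia.
- move=> i x Ex; have [p pT px] := Ex (T i).
  have [[_ _ _ cov] _ _] := HwL i.
  have pw := cov _ pT; pose a := seq.index p (w i).
  have an : (a < n i)%N by rewrite index_mem.
  exists (a%:R / (n i)%:R) => [|c].
    by rewrite divr_ge0 // ler_pdivrMr ?ltr0n // mul1r ler_nat ltnW.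
  apply: cube_dist px; have := gP (a%:R / (n i)%:R) i.
  by rewrite /q slot_frac // nth_index.
Qed.

Lemma base_exceeds (eps : R) M : 0 < eps -> 0 <= M -> exists i, M < eps * B (T i).
Proof.
move=> eps0 M0; have M1 : 0 < M + 1 by rewrite ltr_wpDl.
have [j Hj] := base_grows S (divr_gt0 eps0 M1); exists j.
rewrite mulrAC ler_pdivlMr // mul1r in Hj.
apply: lt_le_trans (_ : M < M + 1) _; first by rewrite ltrDl.
apply: le_trans Hj _; rewrite ler_wpM2l ?(ltW eps0) // ler_weXn2l ?ler1n //; exact: T_ge.
Qed.

(** The image of the parametrization is closed, being compact, and it is dense in the
    limit set because every walk visits all the cells of its level. *)
Lemma limit_curve : curve E.
Proof.
have [n [g [n0 gE gcont gsurj]]] := walk_parametrization.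
have ctsg : continuous g.
  move=> t; apply/cvg_ballP => eps eps0.
  have [i Hi] := base_exceeds eps0 (ler0n R 2).
  have nR : 0 < (n i)%:R :> R by rewrite ltr0n.
  near=> t'; split=> // r c; rewrite ord1 /ball /=.
  rewrite -(ltr_pM2r (base_gt0 R e (T i))); apply: le_lt_trans Hi; apply: gcont.
  rewrite -ltr_pdivlMr // mul1r; near: t'.
  by apply: cvgr_dist_lt; [exact: cvg_id|rewrite invr_gt0].
have ctsgw : {within `[0, 1]%classic, continuous g} by exact: continuous_subspaceT.
split.
  exists g; split=> //; apply/seteqP; split=> [_ [t _ <-]//|x Ex].
  have cl : closed (g @` `[0, 1]%classic).
    apply: compact_closed; first exact: norm_hausdorff.
    by apply: continuous_compact => //; exact: segment_compact.
  rewrite (iffLR (closure_id _) cl) => V /nbhs_ballP[eps /= eps0 sub].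
  have [i Hi] := base_exceeds eps0 (ler0n R 1).
  have [t t01 gt] := gsurj i x Ex.
  exists (g t); split; first by exists t; rewrite //= in_itv.
  apply: sub; split=> // r c; rewrite ord1 /ball /= distrC.
  by rewrite -(ltr_pM2r (base_gt0 R e (T i))); apply: le_lt_trans Hi; apply: gt.
have root0 : none \in cells S 0 by rewrite inE.
have net0 : net_cell S 0 none by rewrite /net_cell root0 -T0 mT.
pose hi : digits d e := [ffun => ord_max]; pose lo : digits d e := [ffun => ord0].
have hic : corner hi by apply/forallP=> i; rewrite ffunE eqxx orbT.
have loc : corner lo by apply/forallP=> i; rewrite ffunE eqxx.
have /andP[hi1 _] := corner_plain net0 hic; have /andP[lo1 _] := corner_plain net0 loc.
have [x Ex xhi] := cell_point R hi1; have [y Ey ylo] := cell_point R lo1.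
exists x, y; split=> // xy; have := xhi ord0; have := ylo ord0.
rewrite xy !ffunE /= mul0n !add0n => /andP[_ h1] /andP[h2 _].
have := le_trans h2 h1; rewrite ler_nat; have := ladder_base S; lia.
Unshelve. all: end_near. Qed.

End Curve.

(** * Counting columns *)

Section ColumnCounts.
Variables (d e : nat) (S : ladder d e).

(** In each column of level [n], one cell out of [b ^ q] is kept as the base of a segment
    of [b ^ q] cells. *)
Definition chunk q n (p : cell d) : bool := in_column S n p && (e.+1 ^ q %| p ord0)%N.

Lemma pattern_column n p : ~~ milestone S n -> in_column S n p -> pattern S n p = columns S n.
Proof. by rewrite /pattern => /negbTE-> ->. Qed.

Lemma count_chunkS q n : ~~ milestone S n ->
  count (chunk q.+1 n.+1) (cells S n.+1) = (mult S n * count (chunk q n) (cells S n))%N.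
Proof.
move=> nm; pose F (p : cell d) (a : digits d e) := chunk q n p && (a ord0 == ord0).
have -> : count (chunk q.+1 n.+1) (cells S n.+1) =
    count (fun p => F (parent e p) (digit e p)) (cells S n.+1).
  apply: eq_count => p; rewrite /F /chunk /= (negbTE nm) -andbA; congr andb.
  have -> : (digit e p ord0 == ord0) = (e.+1 %| p ord0)%N.
    by rewrite -val_eqE /= val_digit /dvdn.
  rewrite ffunE expnSr; apply/idP/andP => [H|[H1 H2]].
    have bp : (e.+1 %| p ord0)%N := dvdn_trans (dvdn_mull _ (dvdnn _)) H.
    by rewrite dvdn_divRL.
  by rewrite -dvdn_divRL.
rewrite count_cells -sum1_count big_distrr /= [RHS]big_mkcond /=.
apply: eq_bigr => p _; case cp: (chunk q n p); last first.
  by apply: eq_card0 => a; rewrite inE /F cp andbF.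
rewrite muln1; have /andP[tp _] := cp; rewrite (pattern_column nm tp).
rewrite -[RHS](card_column_slice (ladder_patterns S n) ord0).
by apply: eq_card => a; rewrite !inE /F cp.
Qed.

Lemma count_chunkD q n : (forall j, (j < q)%N -> ~~ milestone S (n + j)%N) ->
  (count (chunk q (n + q)) (cells S (n + q)) * e.+1 ^ q * size (cells S n) =
   count (in_column S n) (cells S n) * size (cells S (n + q)))%N.
Proof.
elim: q => [|q IH] nm.
  rewrite addn0 muln1; congr (_ * _)%N; apply: eq_count => p.
  by rewrite /chunk dvd1n andbT.
rewrite addnS count_chunkS ?nm // size_cellsS expnS.
have := congr1 (muln (e.+1 * mult S (n + q))) (IH (fun j jq => nm j (ltnW jq))); lia.
Qed.

Lemma count_columnS n : ~~ milestone S n ->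
  count (in_column S n.+1) (cells S n.+1) =
  (e.+1 * mult S n * count (in_column S n) (cells S n))%N.
Proof. by move=> /negbTE nm; rewrite -count_parent; apply: eq_count => p /=; rewrite nm. Qed.

Lemma count_column_milestone n : milestone S n ->
  count (in_column S n.+1) (cells S n.+1) = size (cells S n).
Proof.
move=> mn; pose F (p : cell d) (a : digits d e) := a == ladder_digit d e.
rewrite (eq_count (a2 := fun p => F (parent e p) (digit e p))); last by move=> p /=; rewrite mn.
rewrite count_cells -sum1_size; apply: eq_bigr => p _; rewrite /pattern mn /=.
rewrite -(cards1 (ladder_digit d e)); apply: eq_card => a; rewrite !inE /F.
case: eqP => [->|]; last by rewrite andbF.
by rewrite (connected_ladder (ladder_patterns S n)).
Qed.

Lemma count_column n k : milestone S n -> (forall j, (j < k)%N -> ~~ milestone S (n + j.+1)%N) ->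
  (count (in_column S (n + k.+1)) (cells S (n + k.+1)) * (e.+1 * mult S n) =
   size (cells S (n + k.+1)))%N.
Proof.
move=> mn; elim: k => [|k IH] nm.
  by rewrite addn1 count_column_milestone // size_cellsS mulnC.
rewrite addnS count_columnS ?nm // size_cellsS -IH; last by move=> j jk; apply/nm/ltnW.
lia.
Qed.

Lemma mult_le n : (e.+1 * mult S n <= e.+1 ^ d.+2)%N.
Proof.
rewrite -(card_connected (ladder_patterns S n)) (leq_trans (max_card _)) //.
by rewrite card_ffun !card_ord.
Qed.

(** Exactly one child of each cell of level [T] starts a bundle, and one cell of the
    bundle out of [b ^ q] is kept. *)
Lemma count_chunk_ge T k q : milestone S T ->
  (forall j, (j < k + q)%N -> ~~ milestone S (T + j.+1)%N) ->
  (size (cells S (T + k.+1 + q)) <=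
   count (chunk q (T + k.+1 + q)) (cells S (T + k.+1 + q)) * e.+1 ^ q * e.+1 ^ d.+2)%N.
Proof.
move=> mT nm; set n := (T + k.+1)%N; set c := count _ _.
have H1 : (c * e.+1 ^ q * size (cells S n) =
    count (in_column S n) (cells S n) * size (cells S (n + q)))%N.
  by apply: count_chunkD => j jq; rewrite /n -addnA addSn; apply: nm; rewrite ltn_add2l.
have H2 := count_column mT (fun j jk => nm j (leq_trans jk (leq_addr _ _))).
rewrite -/n in H2.
have s0 := size_cells_gt0 S n; have := mult_le T.
set M := (e.+1 * _)%N in H2 *; set D := (e.+1 ^ d.+2)%N => MD.
rewrite -(leq_pmul2l s0) mulnA [leqRHS](_ : _ = c * e.+1 ^ q * size (cells S n) * D)%N; last by lia.
have Z : (size (cells S n) <= count (in_column S n) (cells S n) * D)%N.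
  by rewrite -H2 leq_mul2l MD orbT.
by rewrite H1 mulnAC leq_mul.
Qed.

End ColumnCounts.

Lemma sum_card_disjoint (I : eqType) (V : finType) (l : seq I) (P : I -> pred V) : uniq l ->
  (forall i j v, i \in l -> j \in l -> P i v -> P j v -> i = j) ->
  (\sum_(i <- l) #|[pred v | P i v]| <= #|V|)%N.
Proof.
move=> ul disj; under eq_bigr do rewrite -sum1_card big_mkcond.
rewrite exchange_big -sum1_card /=; apply: leq_sum => v _.
rewrite -big_mkcond sum1_count (eq_count (a2 := P^~ v)) => [|//].
elim: l ul disj => //= i l IH /andP[il ul] disj.
have {}IH := IH ul (fun i' j' v' i'l j'l => disj i' j' v' (mem_behead (s := i :: l) i'l) (mem_behead (s := i :: l) j'l)).
case Pi : (P i v) => //=.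
rewrite add1n ltnS leqn0 -leqn0 leqNgt -has_count; apply/hasPn => j jl.
apply/negP => Pj; have ij : i = j by apply: (disj i j v); rewrite ?inE ?eqxx ?jl ?orbT.
by rewrite ij jl in il.
Qed.

(** * Counting lattice points *)

Lemma interval_injection (a L M : nat) : (a <= M)%N -> (L + L <= M)%N ->
  exists2 f : 'I_L -> 'I_M, injective f &
    forall l, f l = (a + l)%N :> nat \/ (f l + l.+1)%N = a.
Proof.
move=> aM LM; case: (leqP (a + L) M) => aL.
  have fM (l : 'I_L) : (a + l < M)%N by rewrite (leq_trans _ aL) // ltn_add2l.
  exists (fun l => Ordinal (fM l)) => [l l' []|l]; last by left.
  by move=> /eqP; rewrite eqn_add2l => /eqP/val_inj.
have fa (l : 'I_L) : (l < a)%N by have := ltn_ord l; lia.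
have fM (l : 'I_L) : (a - l.+1 < M)%N by have := fa l; lia.
exists (fun l => Ordinal (fM l)) => [l l' []|l]; last by right; rewrite /= subnK.
by have := fa l; have := fa l' => ? ? ?; apply: val_inj => /=; lia.
Qed.


Section Lattice.
Variables (R : realType) (m M : nat).
Hypothesis M0 : (0 < M)%N.

Definition lattice_point (v : {ffun 'I_m -> 'I_M}) : 'rV[R]_m :=
  \row_i ((v i)%:R / M%:R).

Lemma lattice_in_cube v : unit_cube R m (lattice_point v).
Proof.
move=> i; rewrite mxE divr_ge0 // ler_pdivrMr ?ltr0n // mul1r ler_nat ltnW //.
Qed.

Lemma interval_count (a rho : R) : 0 <= a <= 1 -> rho <= 1 -> 4 <= rho * M%:R ->
  rho * M%:R / 4 <= #|[pred j : 'I_M | `|j%:R / M%:R - a| <= rho]|%:R.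
Proof.
move=> /andP[a0 a1] rho1 rM; have MR : 0 < M%:R :> R by rewrite ltr0n.
pose L := Num.truncn (rho * M%:R / 2).
have rM0 : 0 <= rho * M%:R / 2 by rewrite divr_ge0 // (le_trans _ rM).
have /andP[L1 L2] := truncn_itv rM0; rewrite -/L in L1 L2.
have aM0 : 0 <= a * M%:R by rewrite mulr_ge0 // ltW.
pose j0 := Num.truncn (a * M%:R); have /andP[j1 j2] := truncn_itv aM0; rewrite -/j0 in j1 j2.
rewrite -[L.+1%:R]natr1 in L2; rewrite -[j0.+1%:R]natr1 in j2.
have aM1 : a * M%:R <= M%:R by rewrite ler_piMl // ltW.
have rM1 : rho * M%:R <= M%:R by rewrite ler_piMl // ltW.
apply: (@le_trans _ _ L%:R); first by lra.
have LM : (L + L <= M)%N by rewrite -(ler_nat R) natrD; lra.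
have j0M : (j0 <= M)%N by rewrite -(ler_nat R); lra.
have [f f_inj fE] := interval_injection j0M LM.
rewrite ler_nat -[L in (L <= _)%N]card_ord -(card_imset _ f_inj).
apply: subset_leq_card; apply/fintype.subsetP=> _ /imsetP[l _ ->]; rewrite inE /=.
rewrite -(ler_pM2r MR) -[X in _ * X <= _](gtr0_norm MR) -normrM mulrBl mulfVK ?gt_eqF //.
have lL : l.+1%:R <= L%:R :> R by rewrite ler_nat.
rewrite -[l.+1%:R]natr1 in lL; have l0 : 0 <= l%:R :> R by [].
have [->|/(congr1 (fun z : nat => z%:R : R))] := fE l; first by rewrite natrD ler_norml; lra.
by rewrite natrD -[l.+1%:R]natr1 ler_norml; lra.
Qed.

(** Lattice points play the role of volume: a cube of radius [rho] centred in the unit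
    cube keeps a fixed share of its volume inside, even at a corner. *)
Lemma lattice_count (x : 'rV[R]_m) (rho : R) : unit_cube R m x -> rho <= 1 ->
  4 <= rho * M%:R ->
  (rho * M%:R / 4) ^+ m <=
    #|[pred v : {ffun 'I_m -> 'I_M} | [forall i, `|lattice_point v 0 i - x 0 i| <= rho]]|%:R.
Proof.
move=> xc rho1 rM.
pose F (i : 'I_m) : pred 'I_M := [pred j : 'I_M | `|j%:R / M%:R - x 0 i| <= rho].
have -> : #|[pred v : {ffun 'I_m -> 'I_M} | [forall i, `|lattice_point v 0 i - x 0 i| <= rho]]|
    = (\prod_(i < m) #|F i|)%N.
  have -> : (\prod_(i < m) #|F i|)%N = #|family F|.
    by rewrite card_family foldrE big_image.
  apply: eq_card => v; rewrite inE; apply/forallP/familyP => H i.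
    by have := H i; rewrite mxE inE.
  by have := H i; rewrite mxE inE.
rewrite natr_prod -[m in X in X <= _]card_ord -prodr_const; apply: ler_prod => i _.
by rewrite interval_count ?xc // andbT divr_ge0 // (le_trans _ rM).
Qed.

End Lattice.

(** * Moats around columns *)

Section Moats.
Variables (R : realType) (d e : nat) (S : ladder d e).
Implicit Types (p : cell d) (z : 'rV[R]_d.+2).
Local Notation B n := (e.+1%:R ^+ n : R).

(** Horizontally, [z] is in the cell [p] at depth at least [c] from its sides, the side
    of the cell being the unit of length. *)
Definition deep n p (c : R) z := forall i, i != ord0 ->
  (p i)%:R + c <= z 0 i * B n <= (p i).+1%:R - c.

Definition abreast q n p z := `|z 0 ord0 * B n - (p ord0)%:R| < B q / 2.

(** The limit set lies at depth at least [1 / b = 8 mu] in column cells. The moat is the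
    range of depths from [2 mu] to [6 mu]; points at depth [4 mu] can move by [mu] twice
    without leaving it. *)
Definition moat_unit : R := (8 * e.+1%:R)^-1.
Local Notation mu := moat_unit.

Definition in_box q n p z := deep n p (2 * mu) z /\ abreast q n p z.

Definition in_moat q n p z := in_box q n p z /\ ~ deep n p (6 * mu) z.

Lemma moat_unit_gt0 : 0 < mu.
Proof. by rewrite invr_gt0 mulr_gt0. Qed.

Lemma moat_unit_le : 8 * mu <= 1.
Proof.
rewrite /mu invfM mulrA mulfV ?gt_eqF // mul1r invf_le1 ?ltr0n // ler1n //.
Qed.

Lemma deep_weaken n p c c' z : c' <= c -> deep n p c z -> deep n p c' z.
Proof. by move=> cc' pz i i0; have := pz i i0; lra. Qed.

Lemma deep_move n p c c' z z' : (forall i, `|z' 0 i - z 0 i| * B n <= c') ->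
  deep n p c z -> deep n p (c - c') z'.
Proof.
move=> zz' pz i i0; have := pz i i0; have := zz' i; rewrite scaled_dist ler_norml; lra.
Qed.

Lemma deep_unique n p p' c c' z : 0 < c -> 0 < c' -> deep n p c z -> deep n p' c' z ->
  forall i, i != ord0 -> p i = p' i.
Proof.
move=> c0 c'0 pz p'z i i0; have := pz i i0; have := p'z i i0.
move=> /andP[lo' hi'] /andP[lo hi]; apply/eqP; rewrite eqn_leq.
by apply/andP; split; rewrite -ltnS -(ltr_nat R); lra.
Qed.

Lemma abreast_unique q n p p' z : (e.+1 ^ q %| p ord0)%N -> (e.+1 ^ q %| p' ord0)%N ->
  abreast q n p z -> abreast q n p' z -> p ord0 = p' ord0.
Proof.
move=> /dvdnP[k pk] /dvdnP[k' pk']; rewrite /abreast pk pk' !natrM natrX !ltr_norml => h h'.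
have B0 := base_gt0 R e q.
suff -> : k = k' by [].
apply/eqP; rewrite eqn_leq.
by apply/andP; split; rewrite -ltnS -(ltr_nat R) -(ltr_pM2r B0) -[X in _ < X * _]natr1 mulrDl mul1r; lra.
Qed.

Lemma in_column_ancestor n k p : (forall j, (j < k)%N -> ~~ milestone S (n + j)%N) ->
  in_column S (n + k) p -> in_column S n (ancestor e k p).
Proof.
elim: k p => [|k IH] p nm; first by rewrite addn0 ancestor0.
rewrite addnS /= (negbTE (nm k _)) // ancestorS => /IH; apply => j jk.
exact/nm/ltnW.
Qed.

(** The digits of columns avoid 0 and the top digit, so that whatever is inside a
    column cell is deep inside its ancestors in the bundle. This separates columns
    and makes the moats of different levels disjoint. *)
Lemma deep_ancestor n k p c z : 0 <= c ->
  (forall j, (j < k.+1)%N -> ~~ milestone S (n + j)%N) ->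
  p \in cells S (n + k.+1) -> in_column S (n + k.+1) p ->
  deep (n + k.+1) p c z -> deep n (ancestor e k.+1 p) (8 * mu) z.
Proof.
move=> c0 nm pn cp pz i i0.
have cp1 : ancestor e k p \in cells S n.+1 by apply: cells_ancestor; rewrite addSnnS.
have dp : digit e (ancestor e k p) \in columns S n.
  move: cp1; rewrite mem_cells -ancestorSr => /andP[_].
  rewrite pattern_column //; first by have := nm 0%N; rewrite addn0; apply.
  exact: in_column_ancestor.
have /andP[a0 ae] := column_inner (ladder_patterns S n) dp i0.
rewrite val_digit in a0 ae.
have -> : 8 * mu = e.+1%:R^-1 by rewrite /mu invfM mulrA mulfV ?mul1r // gt_eqF.
rewrite ancestorSr [X in (X%:R + _ <= _ <= _)]ffunE [X in (_ <= _ <= X.+1%:R - _)]ffunE.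
have P0 := base_gt0 R e k.+1.
have := pz i i0; rewrite exprD mulrA => /andP[lo hi].
set P := ancestor e k p i; have PE : P = (p i %/ e.+1 ^ k)%N by rewrite /P ffunE.
have b0 : 0 < e.+1%:R :> R by [].
have Bk := base_gt0 R e k.
have regroup : z 0 i * B n * e.+1%:R * B k = z 0 i * B n * B k.+1 by rewrite exprS mulrA.
have lo1 : P%:R <= z 0 i * B n * e.+1%:R.
  rewrite -(ler_pM2r Bk) regroup; apply: le_trans _ lo.
  apply: (@le_trans _ _ (p i)%:R); last by rewrite lerDl.
  by rewrite PE -natrX -natrM ler_nat leq_trunc_div.
have hi1 : z 0 i * B n * e.+1%:R <= P.+1%:R.
  rewrite -(ler_pM2r Bk) regroup; apply: le_trans hi _.
  apply: (@le_trans _ _ (p i).+1%:R); first by rewrite gerBl.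
  by rewrite PE -natrX -natrM ler_nat ltn_ceil // expn_gt0.
have PD := divn_eq P e.+1.
apply/andP; split; rewrite -(ler_pM2r b0).
  rewrite mulrDl mulVf ?gt_eqF //; apply: le_trans lo1.
  by rewrite {2}PD natrD natrM lerD2l ler1n.
rewrite mulrBl mulVf ?gt_eqF //; apply: le_trans hi1 _.
rewrite lerBrDr natr1 -natrM ler_nat {1}PD mulSn [leqRHS]addnC -!addnS leq_add2l.
by rewrite ltnS.
Qed.

End Moats.

Section Hoelder.
Variables (R : realType) (m d e : nat) (f : 'rV[R]_m -> 'rV[R]_d.+2).
Variables (alpha H : R).
Hypotheses (alpha0 : 0 < alpha) (H1 : 1 <= H).
Hypothesis f_hoelder : forall x y (rho : R), unit_cube R m x -> unit_cube R m y -> 0 <= rho ->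
  (forall i, `|x 0 i - y 0 i| <= rho) -> forall j, `|f x 0 j - f y 0 j| <= H * rho `^ alpha.
Local Notation B n := (e.+1%:R ^+ n : R).
Local Notation mu := (moat_unit R e).

(** If some point of the ball of radius [rho1] is mapped out of the box, walk to it
    from [x] in steps that move the image by at most [mu]: the first step reaching depth
    less than [4 mu] ends inside the moat, with a neighbourhood of radius [rho2]. *)
Lemma box_or_moat n p q x rho1 rho2 : unit_cube R m x -> 8 <= B q ->
  0 <= rho1 -> 0 <= rho2 ->
  H * rho1 `^ alpha * B n <= B q / 4 -> H * rho2 `^ alpha * B n <= mu ->
  deep e n p (8 * mu) (f x) -> `|f x 0 ord0 * B n - (p ord0)%:R| <= 1 ->
  (forall y, unit_cube R m y -> (forall i, `|y 0 i - x 0 i| <= rho1) -> in_box e q n p (f y)) \/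
  (exists2 x', unit_cube R m x' & forall y, unit_cube R m y ->
     (forall i, `|y 0 i - x' 0 i| <= rho2) -> in_moat e q n p (f y)).
Proof.
move=> xc q8 r10 r20 Hr1 Hr2 deepx heightx.
have mu0 := moat_unit_gt0 R e; have mu1 := moat_unit_le R e.
have Bn := base_gt0 R e n; have H0 : 0 < H by apply: lt_le_trans H1.
have close y y' rho c : unit_cube R m y -> unit_cube R m y' -> 0 <= rho ->
    H * rho `^ alpha * B n <= c -> (forall i, `|y 0 i - y' 0 i| <= rho) ->
    forall j, `|f y 0 j - f y' 0 j| * B n <= c.
  move=> yc y'c rho0 Hrho yy' j; apply: le_trans Hrho.
  by rewrite ler_wpM2r ?(ltW Bn) //; apply: f_hoelder.
apply: contrapT => /not_orP[nobox nomoat].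
have {nobox}[y [yc yx nboxy]] : exists y, [/\ unit_cube R m y,
    forall i, `|y 0 i - x 0 i| <= rho1 & ~ in_box e q n p (f y)].
  apply: contrapT => H'; apply: nobox => y yc yx.
  by apply: contrapT => nb; apply: H'; exists y.
have abr w : unit_cube R m w -> (forall i, `|w 0 i - x 0 i| <= rho1) ->
    `|f w 0 ord0 * B n - (p ord0)%:R| <= 1 + B q / 4.
  move=> wc wx; have := close _ _ _ _ wc xc r10 Hr1 wx ord0.
  rewrite scaled_dist; move: heightx; rewrite !ler_norml; lra.
have ndeepy : ~ deep e n p (4 * mu) (f y).
  move=> dy; apply: nboxy; split; first by apply: deep_weaken dy; lra.
  by apply: le_lt_trans (abr y yc yx) _; lra.
pose w := mu / (H * B n); have w0 : 0 < w by rewrite divr_gt0 // mulr_gt0.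
(* The segment from [x] to [y] is cut into [K] steps, each moving the image by at most [mu]. *)
pose K := (Num.bound (rho1 / w `^ alpha^-1)).+1.
have K0 : 0 < K%:R :> R by [].
have stepK : H * (rho1 / K%:R) `^ alpha * B n <= mu.
  rewrite mulrAC -ler_pdivlMl ?mulr_gt0 // [leRHS]mulrC -/w.
  rewrite -[leRHS]powRr1 ?(ltW w0) // -[X in _ <= _ `^ X](mulVf (lt0r_neq0 alpha0)) powRrM.
  apply: powR_le; rewrite ?(ltW alpha0) ?divr_ge0 // ?(ltW K0) //.
  rewrite ler_pdivrMr // mulrC -ler_pdivrMr ?powR_gt0 //.
  apply: le_trans (ltW (archi_boundP _)) _; last by rewrite ler_nat.
  by rewrite divr_ge0 // powR_ge0.
pose c k : 'rV[R]_m := \row_i (x 0 i + k%:R / K%:R * (y 0 i - x 0 i)).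
have fracK k : (k <= K)%N -> 0 <= (k%:R / K%:R : R) <= 1.
  by move=> kK; rewrite divr_ge0 // ler_pdivrMr // mul1r ler_nat.
have cc k : (k <= K)%N -> unit_cube R m (c k).
  move=> /fracK kK i; rewrite mxE; move: kK; move: (_ / _) => a; have := xc i; have := yc i.
  move=> /andP[y0 y1] /andP[x0 x1] /andP[a0 a1].
  have -> : x 0 i + a * (y 0 i - x 0 i) = (1 - a) * x 0 i + a * y 0 i by ring.
  have b0 : 0 <= 1 - a by lra.
  rewrite addr_ge0 ?mulr_ge0 //=.
  have := ler_wpM2l b0 x1; have := ler_wpM2l a0 y1; lra.
have cx k i : (k <= K)%N -> `|c k 0 i - x 0 i| <= rho1.
  move=> /fracK/andP[a0 a1]; rewrite mxE addrC addKr normrM (ger0_norm a0).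
  by rewrite -[leRHS]mul1r ler_pM.
have exk : exists k, `[< ~ deep e n p (4 * mu) (f (c k)) >].
  exists K; apply/asboolP; suff -> : c K = y by [].
  by apply/rowP=> i; rewrite mxE mulfV ?gt_eqF // mul1r addrC subrK.
case: (ex_minnP exk) => -[|k] /asboolP ndeepk kmin.
  apply: ndeepk; suff -> : c 0%N = x by apply: deep_weaken deepx; lra.
  by apply/rowP=> i; rewrite mxE !mul0r addr0.
have kK : (k.+1 <= K)%N.
  apply: kmin; apply/asboolP; suff -> : c K = y by [].
  by apply/rowP=> i; rewrite mxE mulfV ?gt_eqF // mul1r addrC subrK.
have deepk : deep e n p (4 * mu) (f (c k)).
  by apply: contrapT => nd; have := kmin k; rewrite ltnn => H'; have := H' (asboolT nd).
have deepk1 : deep e n p (3 * mu) (f (c k.+1)).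
  have -> : 3 * mu = 4 * mu - mu by ring.
  apply: deep_move deepk; apply: close stepK _; [exact: cc|exact/cc/ltnW|by rewrite divr_ge0|].
  move=> i; rewrite !mxE -natr1.
  have -> : x 0 i + (k%:R + 1) / K%:R * (y 0 i - x 0 i) - (x 0 i + k%:R / K%:R * (y 0 i - x 0 i))
      = (y 0 i - x 0 i) / K%:R by field; rewrite gt_eqF.
  by rewrite normrM ler_pM // ?normr_ge0 // ger0_norm // invr_ge0.
apply: nomoat; exists (c k.+1); first exact: cc.
move=> w' w'c w'k.
have near' := close _ _ _ _ w'c (cc _ kK) r20 Hr2 w'k.
split; first split.
- have -> : 2 * mu = 3 * mu - mu by ring.
  exact: deep_move deepk1.
- have := abr _ (cc _ kK) (fun i => cx _ i kK); have := near' ord0; rewrite scaled_dist /abreast.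
  rewrite !ler_norml !ltr_norml; lra.
- move=> d6; apply: ndeepk; have : deep e n p (6 * mu - mu) (f (c k.+1)).
    by apply: deep_move d6 => i; rewrite distrC.
  by apply: deep_weaken; lra.
Qed.

End Hoelder.

(** * No Hoelder map covers the limit set *)

Lemma hoelder_sup (R : realType) m n (alpha : R) (f : 'rV[R]_m -> 'rV[R]_n) :
  0 <= alpha -> hoelder_on alpha (unit_cube R m) f ->
  exists2 H, 1 <= H & forall x y (rho : R), unit_cube R m x -> unit_cube R m y -> 0 <= rho ->
    (forall i, `|x 0 i - y 0 i| <= rho) -> forall j, `|f x 0 j - f y 0 j| <= H * rho `^ alpha.
Proof.
move=> a0 [H fH]; exists (`|H| * m%:R `^ alpha + 1).
  by rewrite lerDr mulr_ge0 // powR_ge0.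
move=> x y rho xc yc rho0 xy j.
have := enorm_coord (f x - f y) j; rewrite !mxE => /le_trans; apply.
apply: le_trans (fH x y xc yc) _.
have nxy : enorm (x - y) `^ alpha <= m%:R `^ alpha * rho `^ alpha.
  rewrite -powRM //; apply: powR_le; rewrite ?enorm_ge0 //.
  by apply: enorm_le => // i; rewrite !mxE.
have h1 : H * enorm (x - y) `^ alpha <= `|H| * enorm (x - y) `^ alpha.
  by rewrite ler_wpM2r ?powR_ge0 // ler_norm.
have h2 := ler_wpM2l (normr_ge0 H) nxy; have := powR_ge0 rho alpha.
move: h1 h2; rewrite mulrDl mul1r mulrA; lra.
Qed.

Lemma level_gap T q j j' : (j < j')%N ->
  (T + j'.+1 + q = T + j.+1 + q + (j' - j).-1.+1)%N.
Proof. lia. Qed.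

Lemma level_gap_lt q j j' J i : (j < j')%N -> (j' < J)%N -> (i < (j' - j).-1.+1)%N ->
  (j + (q + i) < J + q + 1)%N.
Proof. lia. Qed.

Section NotHoelder.
Variables (R : realType) (d e : nat) (S : ladder d e) (s : R) (m : nat).
Hypotheses (s1 : 1 < s) (m1 : (1 <= m)%N).
Hypothesis size_S : forall n, 2^-1 * (e.+1%:R ^+ n) `^ s <= (size (cells S n))%:R.
Hypothesis long_columns : forall J, exists2 T, milestone S T &
  forall j, (j < J)%N -> ~~ milestone S (T + j.+1)%N.
Local Notation B n := (e.+1%:R ^+ n : R).
Local Notation E := (@limit_set R d e S).
Local Notation mu := (moat_unit R e).

Lemma box_unique q n (p p' : cell d) (z : 'rV[R]_d.+2) : (e.+1 ^ q %| p ord0)%N ->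
  (e.+1 ^ q %| p' ord0)%N -> in_box e q n p z -> in_box e q n p' z -> p = p'.
Proof.
move=> pq p'q [dp ap] [dp' ap']; have mu0 : 0 < 2 * mu by rewrite mulr_gt0 // moat_unit_gt0.
apply/ffunP=> i; case: (eqVneq i ord0) => [->|i0]; first exact: abreast_unique ap ap'.
exact: deep_unique dp dp' i i0.
Qed.

(** A point of the moat at the finer level is deep in the ancestor at the coarser level,
    while a point of the moat at the coarser level is not. *)
Lemma moat_levels q n k (p p' : cell d) (z : 'rV[R]_d.+2) :
  (forall j, (j < k.+1)%N -> ~~ milestone S (n + j)%N) ->
  p' \in cells S (n + k.+1) -> in_column S (n + k.+1) p' ->
  in_moat e q n p z -> in_moat e q (n + k.+1) p' z -> False.
Proof.
move=> nm p'n cp' [[dp _] ndp] [[dp' _] _]; apply: ndp.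
have mu0 := moat_unit_gt0 R e; have mu2 : 0 < 2 * mu by rewrite mulr_gt0.
have mu8 : 0 < 8 * mu by rewrite mulr_gt0.
have danc := deep_ancestor (ltW mu2) nm p'n cp' dp'.
have same := deep_unique mu2 mu8 dp danc.
move=> i i0; rewrite (same i i0); have := danc i i0; lra.
Qed.

Lemma column_center n p : ~~ milestone S n -> p \in cells S n -> in_column S n p ->
  exists x, [/\ E x, deep e n p (8 * mu) x & `|x 0 ord0 * B n - (p ord0)%:R| <= 1].
Proof.
move=> nm pn cp.
have /card_gt0P[a aL] : (0 < #|columns S n|)%N.
  by rewrite (card_columns (ladder_patterns S n)) muln_gt0 ladder_mult.
have cn : child p a \in cells S (n + 1).
  by rewrite addn1 mem_cells parent_child digit_child pn pattern_column.
have cc : in_column S (n + 1) (child p a) by rewrite addn1 /= (negbTE nm) parent_child.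
have [x Ex xc] := cell_point R cn; exists x; split=> //.
  have -> : p = ancestor e 1 (child p a) by rewrite ancestor1 parent_child.
  apply: (deep_ancestor (lexx 0) _ cn cc) => [[|j] //|i _]; first by rewrite addn0.
  by have := xc i; rewrite addr0 subr0.
have := cube_ancestor xc ord0; rewrite ancestor1 parent_child ler_norml -natr1; lra.
Qed.

(** [rho1] and [rho2] are the radii for which [box_or_moat] applies with equality;
    the volumes of the two balls differ by the factor [(2 b ^ q.+1) `^ s], which
    weights the moat. *)
Lemma chunk_budget (f : 'rV[R]_m -> 'rV[R]_d.+2) (H : R) q n M :
  1 <= H -> (forall x y (rho : R), unit_cube R m x -> unit_cube R m y -> 0 <= rho ->
    (forall i, `|x 0 i - y 0 i| <= rho) ->
    forall j, `|f x 0 j - f y 0 j| <= H * rho `^ (m%:R / s)) ->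
  E `<=` f @` unit_cube R m -> 8 <= B q -> (q <= n)%N -> ~~ milestone S n ->
  4 <= (mu / (H * B n)) `^ (s / m%:R) * M%:R -> (0 < M)%N ->
  forall p, p \in cells S n -> chunk S q n p ->
  (B q / (4 * H * B n)) `^ s * (M%:R / 4) ^+ m <=
    #|[pred v : {ffun 'I_m -> 'I_M} | `[< in_box e q n p (f (lattice_point R v)) >]]|%:R +
    (2 * e.+1%:R * B q) `^ s *
    #|[pred v : {ffun 'I_m -> 'I_M} | `[< in_moat e q n p (f (lattice_point R v)) >]]|%:R.
Proof.
move=> H1 fH Ef q8 qn nm M4 M0 p pn /andP[cp _].
have s_gt0 : 0 < s by apply: lt_trans s1.
have mR : 0 < m%:R :> R by rewrite ltr0n.
have H0 : 0 < H by apply: lt_le_trans H1.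
have Bn := base_gt0 R e n; have Bq := base_gt0 R e q; have mu0 := moat_unit_gt0 R e.
have mu1 := moat_unit_le R e.
have alpha0 : 0 < m%:R / s by rewrite divr_gt0.
have root_le1 w : 0 <= w -> w <= 1 -> w `^ (s / m%:R) <= 1.
  move=> w0 w1; rewrite -[leRHS](powR1r (s / m%:R)); apply: powR_le => //.
  by rewrite divr_ge0 // ltW.
have rootK w : 0 <= w -> (w `^ (s / m%:R)) `^ (m%:R / s) = w.
  move=> w0; rewrite -powRrM -[RHS]powRr1 //; congr (_ `^ _); field.
  by rewrite !gt_eqF.
have rootm w : 0 <= w -> (w `^ (s / m%:R)) ^+ m = w `^ s.
  move=> w0; rewrite -powR_mulrn ?powR_ge0 // -powRrM mulfVK // gt_eqF //.
pose w1 := B q / (4 * H * B n); pose w2 := mu / (H * B n).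
have HB : 0 < H * B n by rewrite mulr_gt0.
have w1_ge0 : 0 <= w1 by rewrite divr_ge0 ?(ltW Bq) // -mulrA mulr_ge0 // ltW.
have w2_gt0 : 0 < w2 by rewrite divr_gt0.
have w2_ge0 := ltW w2_gt0.
have BqB : B q <= B n by rewrite ler_weXn2l // ler1n.
have HBn : B n <= H * B n by rewrite ler_peMl // ltW.
have w1_le1 : w1 <= 1.
  by rewrite ler_pdivrMr -?mulrA ?mulr_gt0 // mul1r; lra.
have B1 : 1 <= B n by rewrite exprn_ege1 // ler1n.
have w2_le1 : w2 <= 1 by rewrite ler_pdivrMr // mul1r; lra.
have w12 : w1 = 2 * e.+1%:R * B q * w2.
  by rewrite /w1 /w2 /moat_unit; field; rewrite !gt_eqF.
have b1 : 1 <= e.+1%:R :> R by rewrite ler1n.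
have w2w1 : w2 <= w1.
  have q1 : 1 <= B q by lra.
  rewrite w12 ler_peMl //; have := ler_pM ler01 ler01 b1 q1; lra.
have M4' : 4 <= w1 `^ (s / m%:R) * M%:R.
  apply: le_trans M4 _; rewrite ler_wpM2r //; apply: powR_le => //.
  by rewrite divr_ge0 // ltW.
have [y [Ey dy hy]] := column_center nm pn cp.
have [x xc fx] := Ef y Ey; rewrite -fx in dy hy.
have eq1 : (w1 `^ (s / m%:R) * M%:R / 4) ^+ m = w1 `^ s * (M%:R / 4) ^+ m.
  by rewrite -mulrA exprMn rootm.
have eq2 : (w2 `^ (s / m%:R) * M%:R / 4) ^+ m = w2 `^ s * (M%:R / 4) ^+ m.
  by rewrite -mulrA exprMn rootm.
have kap0 : 0 <= (2 * e.+1%:R * B q) `^ s by apply: powR_ge0.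
have [|| inbox|[x' x'c inmoat]] := @box_or_moat R m d e f (m%:R / s) H alpha0 H1 fH n p q x
  (w1 `^ (s / m%:R)) (w2 `^ (s / m%:R)) xc q8 (powR_ge0 _ _) (powR_ge0 _ _) _ _ dy hy.
- rewrite rootK // /w1 le_eqVlt; apply/orP; left; apply/eqP; field; by rewrite !gt_eqF.
- rewrite rootK // /w2 le_eqVlt; apply/orP; left; apply/eqP; field; by rewrite !gt_eqF.
- have := lattice_count M0 xc (root_le1 _ w1_ge0 w1_le1) M4'; rewrite eq1 => /le_trans; apply.
  rewrite -[leLHS]addr0 lerD ?mulr_ge0 // ler_nat subset_leq_card //.
  apply/fintype.subsetP=> v; rewrite !inE => /forallP vx; apply: inbox => //.
  exact: lattice_in_cube.
have := lattice_count M0 x'c (root_le1 _ w2_ge0 w2_le1) M4; rewrite eq2 => cnt.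
apply: (@le_trans _ _ ((2 * e.+1%:R * B q) `^ s * (w2 `^ s * (M%:R / 4) ^+ m))).
  rewrite -/w1 w12 powRM ?mulrA // mulr_ge0 // ltW //.
rewrite -[leLHS]add0r lerD // ler_wpM2l //; apply: le_trans cnt _.
rewrite ler_nat subset_leq_card //.
apply/fintype.subsetP=> v; rewrite !inE => /forallP vx; apply: inmoat => //.
exact: lattice_in_cube.
Qed.

(** Summing [chunk_budget] over the segments of one level, the boxes account for at
    most the whole volume, while the left-hand sides add up to twice that volume
    once [b ^ q] is large. So the moats of each level contain a fixed share of the
    volume, whereas those of all levels together are disjoint. *)
Lemma limit_not_hoelder : ~ exists f : 'rV[R]_m -> 'rV[R]_d.+2,
  hoelder_on (m%:R / s) (unit_cube R m) f /\ E `<=` f @` unit_cube R m.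
Proof.
move=> [f [hf Ef]].
have s_gt0 : 0 < s by apply: lt_trans s1.
have mR : 0 < m%:R :> R by rewrite ltr0n.
have [H H1 fH] := hoelder_sup (divr_ge0 (ler0n R m) (ltW s_gt0)) hf.
have H0 : 0 < H by apply: lt_le_trans H1.
have mu0 := moat_unit_gt0 R e.
pose beta : R := e.+1%:R ^+ d.+2; pose h : R := (4 * H) `^ s; pose f4 : R := 4 ^+ m.
have beta0 : 0 < beta by exact: exprn_gt0.
have h0 : 0 < h by rewrite powR_gt0 // mulr_gt0.
have f40 : 0 < f4 by exact: exprn_gt0.
(* The constant for which the left-hand sides of one level add up to [2 M ^ m]. *)
pose Y := 4 * beta * h * f4.
have Y0 : 0 < Y by exact: mulr_gt0 (mulr_gt0 (mulr_gt0 _ beta0) h0) f40.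
have s1' : 0 < s - 1 by rewrite subr_gt0.
have [q [q8 qY]] : exists q, 8 <= B q /\ Y <= B q `^ (s - 1).
  pose Z := 8 + Y `^ (s - 1)^-1.
  have Yr := powR_ge0 Y (s - 1)^-1; have Z0 : 0 < Z by rewrite /Z; lra.
  have Zi : 0 < Z^-1 by rewrite invr_gt0.
  have [q Hq] := base_grows S Zi; exists q; rewrite ler_pdivlMl // mulr1 /Z in Hq; split; first by lra.
  rewrite -[leLHS]powRr1 ?(ltW Y0) // -[X in Y `^ X](mulVf (lt0r_neq0 s1')) powRrM.
  apply: powR_le; rewrite ?(ltW s1') //; lra.
pose kappa := (2 * e.+1%:R * B q) `^ s.
have kappa0 : 0 <= kappa by apply: powR_ge0.
(* Each level of moats takes a share [1 / kappa] of the volume: [J > kappa] levels suffice. *)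
pose J := Num.bound kappa; have kJ : kappa < J%:R by apply: archi_boundP.
have [T mT nmT] := long_columns (J + q + 1).
pose t j := (T + j.+1 + q)%N.
have nm_t j : (j < J)%N -> ~~ milestone S (t j).
  move=> jJ; rewrite /t -addnA addSn; apply: nmT.
  by rewrite addn1 ltnS leq_add2r ltnW.
have [M M0 M4] : exists2 M, (0 < M)%N & forall j, (j < J)%N ->
    4 <= (mu / (H * B (t j))) `^ (s / m%:R) * M%:R.
  pose w := (mu / (H * B (t J))) `^ (s / m%:R).
  have w0 : 0 < w by rewrite powR_gt0 // divr_gt0 // mulr_gt0 // base_gt0.
  exists (Num.bound (4 / w)).+1 => // j jJ.
  have ww : w <= (mu / (H * B (t j))) `^ (s / m%:R).
    apply: powR_le; rewrite ?divr_ge0 ?(ltW s_gt0) ?(ltW mu0) ?mulr_ge0 ?(ltW H0) ?(ltW (base_gt0 R e _)) //.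
    rewrite ler_wpM2l ?(ltW mu0) // lef_pV2 ?posrE ?mulr_gt0 ?base_gt0 //.
    by rewrite ler_wpM2l ?(ltW H0) // ler_weXn2l ?ler1n // leq_add2r leq_add2l ltnS ltnW.
  apply: (@le_trans _ _ (w * (Num.bound (4 / w)).+1%:R)); last by rewrite ler_wpM2r.
  rewrite mulrC -ler_pdivrMr //; apply: le_trans (ltW (archi_boundP _)) _.
    by rewrite divr_ge0 // ltW.
  by rewrite ler_nat.
pose moat j p := [pred v : {ffun 'I_m -> 'I_M} |
  `[< in_moat e q (t j) p (f (lattice_point R v)) >]].
pose box j p := [pred v : {ffun 'I_m -> 'I_M} |
  `[< in_box e q (t j) p (f (lattice_point R v)) >]].
pose chunks j := [seq p <- cells S (t j) | chunk S q (t j) p].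
have cardV : #|{ffun 'I_m -> 'I_M}| = (M ^ m)%N by rewrite card_ffun !card_ord.
have level j : (j < J)%N -> M%:R ^+ m <= kappa * (\sum_(p <- chunks j) #|moat j p|)%:R.
  move=> jJ; have P0 : 0 < B (t j) `^ s by exact/powR_gt0/base_gt0.
  pose X := (B q / (4 * H * B (t j))) `^ s * (M%:R / 4) ^+ m.
  have budget : (size (chunks j))%:R * X <=
      (\sum_(p <- chunks j) #|box j p|)%:R + kappa * (\sum_(p <- chunks j) #|moat j p|)%:R.
    rewrite -sum1_size !natr_sum mulr_suml big_distrr /= -big_split /=.
    under eq_bigr do rewrite mul1r.
    rewrite big_seq [leRHS]big_seq; apply: ler_sum => p; rewrite mem_filter => /andP[cp pn].
    have qt : (q <= t j)%N by rewrite /t leq_addl.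
    have := chunk_budget H1 fH Ef q8 qt (nm_t j jJ) (M4 j jJ) M0 pn cp.
    exact.
  have boxes : (\sum_(p <- chunks j) #|box j p| <= M ^ m)%N.
    rewrite -cardV; apply: (sum_card_disjoint (P := fun p v => `[< in_box e q (t j) p (f (lattice_point R v)) >])).
      by rewrite filter_uniq // cells_uniq.
    move=> p p' v; rewrite !mem_filter => /andP[/andP[_ pq] _] /andP[/andP[_ p'q] _].
    by move=> /asboolP pb /asboolP p'b; exact: box_unique pb p'b.
  suff many : 2 * M%:R ^+ m <= (size (chunks j))%:R * X.
    by rewrite -(ler_nat R) natrX in boxes; have := le_trans many budget; lra.
  rewrite /X powRMV ?(ltW (base_gt0 R e _)) ?mulr_ge0 ?(ltW H0) ?(ltW (base_gt0 R e _)) //.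
  rewrite [(4 * H * _) `^ s]powRM ?mulr_ge0 ?(ltW H0) ?(ltW (base_gt0 R e _)) // -/h.
  rewrite exprMn exprVn -/f4 -(mulr_powRB1 (ltW (base_gt0 R e q)) s_gt0).
  have := count_chunk_ge mT (k := j) (q := q) _; rewrite -/(t j) -size_filter -/(chunks j) => Hc.
  have {Hc} : 2^-1 * B (t j) `^ s <= (size (chunks j))%:R * B q * beta.
    apply: le_trans (size_S (t j)) _; rewrite /beta -!natrX -!natrM ler_nat; apply: Hc => i ij.
    by apply: nmT; rewrite (leq_trans ij) // addn1 leqW // leq_add2r ltnW.
  move: (B q `^ (s - 1)) qY => U qY.
  move: (size _)%:R (B (t j) `^ s) P0 (B q) (base_gt0 R e q) (M%:R ^+ m)
    (exprn_ge0 m (ler0n R M)) => c P P0 u u0 Mm Mm0 Hc.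
  have key : 2 * (h * P * f4) <= c * u * U.
    rewrite -(ler_pM2r beta0); have := ler_wpM2l (ltW P0) qY; rewrite /Y => K1.
    have U0 : 0 <= U by apply: le_trans qY; rewrite ltW.
    have := ler_wpM2r U0 Hc; lra.
  have -> : c * (u * U / (h * P) * (Mm / f4)) = (c * u * U) * (Mm / (h * P * f4)).
    by field; rewrite !gt_eqF.
  have -> : 2 * Mm = 2 * (h * P * f4) * (Mm / (h * P * f4)) by field; rewrite !gt_eqF.
  by rewrite ler_wpM2r // divr_ge0 // ltW // !mulr_gt0.
have moats : (\sum_(j <- iota 0 J) \sum_(p <- chunks j) #|moat j p| <= M ^ m)%N.
  rewrite -cardV -(big_allpairs_dep (h := fun (j : nat) (p : cell d) => (j, p)) (r1 := iota 0 J) (r2 := chunks)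
    (F := fun x => #|moat x.1 x.2|)).
  apply: (sum_card_disjoint (P := fun x v => moat x.1 x.2 v)).
    apply: allpairs_uniq_dep => [|j _|]; [exact: iota_uniq| |by move=> [? ?] [? ?] _ _ /= [-> ->]].
    by rewrite filter_uniq // cells_uniq.
  have lower j j' p p' v : (j < j' < J)%N -> p' \in chunks j' -> moat j p v -> moat j' p' v -> False.
    move=> /andP[jj' j'J]; rewrite mem_filter => /andP[/andP[cp' _] p'n].
    have tE : t j' = (t j + (j' - j).-1.+1)%N := level_gap T q jj'.
    move=> /asboolP mp /asboolP; rewrite tE in cp' p'n * => mp'.
    apply: moat_levels p'n cp' mp mp' => i ij.
    rewrite /t -!addnA addSn; apply: nmT; exact: level_gap_lt jj' j'J ij.
  move=> [j p] [j' p'] v /allpairsPdep[j1 [p1 [j1J p1n [-> ->]]]].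
  move=> /allpairsPdep[j2 [p2 [j2J p2n [-> ->]]]] /= mp mp'.
  rewrite !mem_iota /= add0n in j1J j2J.
  case: (ltngtP j1 j2) => [lt|lt|E].
  - by case: (lower j1 j2 p1 p2 v) => //; rewrite lt.
  - by case: (lower j2 j1 p2 p1 v) => //; rewrite lt.
  - congr (_, _) => //; move: mp mp' p1n p2n; rewrite -E !mem_filter.
    move=> /asboolP[mp _] /asboolP[mp' _] /andP[/andP[_ p1q] _] /andP[/andP[_ p2q] _].
    exact: box_unique mp mp'.
have Mm0 : 0 < M%:R ^+ m :> R by rewrite exprn_gt0 // ltr0n.
have total : J%:R * M%:R ^+ m <= kappa * M%:R ^+ m.
  apply: (@le_trans _ _ (\sum_(j <- iota 0 J) kappa * (\sum_(p <- chunks j) #|moat j p|)%:R)).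
    have -> : J%:R * M%:R ^+ m = \sum_(j <- iota 0 J) (M%:R ^+ m : R).
      by rewrite big_const_seq count_predT size_iota iter_addr addr0 mulr_natl.
    by rewrite big_seq [leRHS]big_seq; apply: ler_sum => j; rewrite mem_iota => /level.
  rewrite -big_distrr /= ler_wpM2l // -natr_sum -natrX ler_nat //.
rewrite ler_pM2r // in total; by have := le_lt_trans total kJ; rewrite ltxx.
Qed.

End NotHoelder.

(** * Choice of the parameters *)

(** The triangular numbers serve as milestones: their gaps tend to infinity. *)
Fixpoint triangle (i : nat) : nat := if i is j.+1 then (triangle j + j.+1)%N else 0%N.

Lemma triangle_mono i j : (i <= j)%N -> (triangle i <= triangle j)%N.
Proof.
move=> /subnK <-; elim: (j - i)%N => // k IH.
by rewrite addSn /= (leq_trans IH) // leq_addr.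
Qed.

Lemma triangle_ge i : (i <= triangle i)%N.
Proof. by case: i => // i /=; rewrite leq_addl. Qed.

Definition is_triangle (n : nat) := has (fun i => triangle i == n) (iota 0 n.+1).

Lemma is_triangleT i : is_triangle (triangle i).
Proof. by apply/hasP; exists i => //; rewrite mem_iota /= add0n ltnS triangle_ge. Qed.

Lemma between_triangles i j : (0 < j < i.+1)%N -> ~~ is_triangle (triangle i + j).
Proof.
move=> /andP[j0 ji]; apply/hasPn => k _; case: (leqP k i) => ki.
  by rewrite neq_ltn (leq_ltn_trans (triangle_mono ki)) // -[ltnLHS]addn0 ltn_add2l.
by rewrite neq_ltn (leq_trans _ (triangle_mono ki)) ?orbT //= ltn_add2l.
Qed.

Section Multiplicities.
Variables (R : realType) (beta : R) (c : nat).
Hypotheses (c1 : (1 <= c)%N) (cb : c%:R <= beta) (bc : beta < c.+1%:R).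

(** The target [beta] is [b ^ (s - 1)], which is seldom an integer. Multiplying by [c.+1]
    below the target and by [c] above it keeps the ratio of the number of cells to
    [b ^ (n s)] bounded. *)
Fixpoint ratio (n : nat) : R :=
  if n is n'.+1 then ratio n' * (if ratio n' <= 1 then c.+1 else c)%:R / beta else 1.

Definition greedy (n : nat) : nat := if ratio n <= 1 then c.+1 else c.

Lemma ratio_bounds n : 2^-1 <= ratio n <= 2.
Proof.
have c1R : 1 <= c%:R :> R by rewrite ler1n.
have b0 : 0 < beta by rewrite (lt_le_trans _ cb) // ltr0n.
have bc' := bc; rewrite -[c.+1%:R]natr1 in bc'; have cb' := cb.
elim: n => [|n IH]; first by apply/andP; split => /=; lra.
have /andP[lo hi] := IH; have r0 : 0 <= ratio n by apply: le_trans lo; rewrite invr_ge0.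
rewrite /=; case: (leP (ratio n) 1) => r1; rewrite ler_pdivlMr // ler_pdivrMr //.
  rewrite -[c.+1%:R]natr1; have h1 : ratio n * beta <= ratio n * (c%:R + 1) by rewrite ler_wpM2l // ltW.
  have h2 := ler_wpM2r (ltW b0) lo.
  have h3 : ratio n * (c%:R + 1) <= 1 * (c%:R + 1) by rewrite ler_wpM2r //; lra.
  by apply/andP; split; lra.
have h1 : ratio n * c%:R <= ratio n * beta by rewrite ler_wpM2l.
have h2 := ler_wpM2r (ltW b0) hi.
have h3 : 1 * c%:R <= ratio n * c%:R by rewrite ler_wpM2r // ltW.
by apply/andP; split; lra.
Qed.

End Multiplicities.

Lemma size_cells_ratio (R : realType) d e (S : ladder d e) (s : R) c : 1 < s ->
  (forall n, mult S n = greedy (e.+1%:R `^ (s - 1)) c n) ->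
  forall n, (size (cells S n))%:R = ratio (e.+1%:R `^ (s - 1)) c n * (e.+1%:R ^+ n) `^ s.
Proof.
move=> s1 mS; elim=> [|n IH]; first by rewrite /= expr0 powR1 mulr1.
rewrite size_cellsS !natrM IH mS /=.
have b0 : 0 < e.+1%:R `^ (s - 1) :> R by rewrite powR_gt0.
rewrite exprS powRM ?exprn_ge0 // -(mulr_powRB1 (ler0n R e.+1) (lt_trans ltr01 s1)).
by rewrite /greedy; field; rewrite gt_eqF.
Qed.

(** With [b = 2 h] and [h] large, [b ^ (s - 1)] exceeds any given constant because
    [s > 1], and is less than half of [h ^ d.+1] because [s < d.+2]: there is room for
    [c] columns with horizontal coordinates at most [h]. *)
Lemma ladder_exists (R : realType) (d : nat) (s : R) : 1 < s -> s < d.+2%:R ->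
  exists e (S : ladder d e),
    [/\ milestone S =1 is_triangle &
      forall n, 2^-1 * (e.+1%:R ^+ n) `^ s <= (size (cells S n))%:R
                  <= 2 * (e.+1%:R ^+ n) `^ s].
Proof.
move=> s1 sd; have s1' : 0 < s - 1 by rewrite subr_gt0.
have sd' : 0 < d.+2%:R - s by rewrite subr_gt0.
pose A : R := (2 ^ (d + 5))%:R; have A0 : 0 <= A by [].
pose X := A `^ (s - 1)^-1; pose Y := (2 `^ s) `^ (d.+2%:R - s)^-1 : R.
have [h [h4 hX hY]] : exists h : nat, [/\ (4 <= h)%N, X <= h%:R & Y <= h%:R].
  exists (4 + (Num.bound X + Num.bound Y))%N; split; first exact: leq_addr.
    by rewrite (le_trans (ltW (archi_boundP _))) ?powR_ge0 // ler_nat; lia.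
  by rewrite (le_trans (ltW (archi_boundP _))) ?powR_ge0 // ler_nat; lia.
pose e := (h.*2).-1; have eE : e.+1 = h.*2 by rewrite prednK // double_gt0; lia.
pose beta : R := e.+1%:R `^ (s - 1).
have h0 : 0 < h%:R :> R by rewrite ltr0n; lia.
have bA : A <= beta.
  rewrite -[leLHS]powRr1 // -[X in A `^ X](mulVf (lt0r_neq0 s1')) powRrM -/X.
  apply: powR_le; rewrite ?(ltW s1') ?powR_ge0 // (le_trans hX) // ler_nat eE; lia.
have b_ge0 : 0 <= beta by apply: powR_ge0.
have b1 : 1 <= beta by apply: le_trans bA; rewrite ler1n expn_gt0.
have hb : 2 * beta <= h%:R ^+ d.+1.
  have Yh : 2 `^ s <= h%:R `^ (d.+2%:R - s).
    rewrite -[leLHS]powRr1 ?powR_ge0 // -[X in _ `^ X <= _](mulVf (lt0r_neq0 sd')) powRrM -/Y.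
    by apply: powR_le; rewrite ?(ltW sd') ?powR_ge0.
  rewrite /beta eE -muln2 natrM mulrC powRM //.
  have -> : h%:R `^ (s - 1) * 2 `^ (s - 1) * 2 = h%:R `^ (s - 1) * 2 `^ s.
    by rewrite -mulrA [_ * 2]mulrC mulr_powRB1 // (lt_trans ltr01).
  apply: le_trans (ler_wpM2l (powR_ge0 _ _) Yh) _.
  rewrite -powRD; last by rewrite (lt0r_neq0 h0) implybT.
  rewrite -powR_mulrn ?(ltW h0) //.
  by rewrite le_eqVlt; apply/orP; left; apply/eqP; congr (_ `^ _); rewrite -[d.+2%:R]natr1; ring.
pose c := Num.truncn beta; have /andP[cb bc] := truncn_itv b_ge0.
have cA : (2 ^ (d + 5) <= c)%N by rewrite truncn_ge_nat.
have ch : (c.+1 <= h ^ d.+1)%N.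
  rewrite -(ler_nat R) -natr1 natrX; apply: le_trans hb; lra.
have c1 : (1 <= c)%N by rewrite (leq_trans _ cA) // expn_gt0.
have gc n : (c <= greedy beta c n <= c.+1)%N by rewrite /greedy; case: ifP; rewrite leqnn leqnSn.
have pats n : exists KL : {set digits d e} * {set digits d e},
    pattern_pair (greedy beta c n) KL.1 KL.2.
  have /andP[g1 g2] := gc n.
  have [|||K [L HKL]] := @pattern_pair_exists d e h (greedy beta c n) h4.
  - by rewrite eE.
  - exact: leq_trans cA g1.
  - exact: leq_trans g2 ch.
  - by exists (K, L).
have [KL HKL] := choice pats.
have g0 n : (0 < greedy beta c n)%N by have /andP[g1 _] := gc n; apply: leq_trans g1.
have e1 : (1 < e)%N by rewrite -ltnS eE (@leq_trans 4.*2) // leq_double.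
exists e, (Ladder is_triangle HKL g0 e1); split=> // n.
rewrite (size_cells_ratio (c := c) s1) //.
have /andP[r1 r2] := ratio_bounds c1 cb bc n.
by rewrite !ler_wpM2r ?powR_ge0.
Qed.

Theorem proposition9p4 (R : realType) (N : nat) (s : R) (m : nat) :
  (2 <= N)%N -> 1 < s -> s < N%:R -> (1 <= m)%N -> m%:R <= s ->
  exists E : set 'rV[R]_N,
    [/\ curve E,
        ahlfors_regular s E &
        ~ exists f : 'rV[R]_m -> 'rV[R]_N,
            hoelder_on (m%:R / s) (unit_cube R m) f /\
            E `<=` f @` unit_cube R m].
Proof.
case: N => [|[|d]] // _ s1 sN m1 _.
have [e [S [mS sizeS]]] := ladder_exists s1 sN.
exists (@limit_set R d e S); split.
- apply: (@limit_curve R d e S triangle id) => // [i|i j ij]; first by rewrite mS is_triangleT.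
  by rewrite mS between_triangles.
- exact: ladder_ahlfors.
- apply: limit_not_hoelder => // [n|J]; first by have /andP[] := sizeS n.
  exists (triangle J) => [|j jJ]; first by rewrite mS is_triangleT.
  by rewrite mS between_triangles.
Qed.
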